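(* Let $A\in L^{\infty}(\mathfrak{S},\mathbb{R}^{n\times n};\mu)$ and $B\in L^{\infty}(\mathfrak{S},\mathbb{R}^{n\times m};\mu)$, and assume that the system $\partial_t^\alpha x_\sigma(t)=A(\sigma)x_\sigma(t)+B(\sigma)u(t)$, $x_\sigma(0)=x_{0,\sigma}$, is exactly controllable in average in time $T$. Then, for any $x_{0,\bullet}\in L^1(\mathfrak{S},H;\mu)$ and $x_1\in H$, the unique minimizer of the problem $$\min_{u\in L^\infty(0,T;U)}\|u\|_{L^2_{\alpha-1}(0,T;U)}\quad\text{subject to}\quad \mathbb{E}(x_\bullet(T;x_{0,\bullet};u))=x_1$$ is given by $$u_a(t)=\mathbb{E}\left(B(\bullet)^{\top}E_{\alpha,\alpha}((T-t)^{\alpha}A(\bullet)^\top)\right)\hat y_T,$$ where $\hat y_T\in H$ is a minimizer over $H$ of the functional $\mathcal{J}^a$ (associated with $x_{0,\bullet}$ and $x_1$) defined by $$\mathcal{J}^a(y_T)=\frac12\int_0^T (T-t)^{1-\alpha}\|\mathbb{E}(B(\bullet)^\top y_\bullet(t;y_T))\|_U^2\,dt-\langle x_1,y_T\rangle_H+\mathbb{E}\left(\langle x_{0,\bullet},(I^{1-\alpha}_{T-t}y_\bullet)(0;y_T)\rangle_H\right).$$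
   Context: Setting: $\alpha\in(0,1)$, $T>0$, $n,m\ge 1$, $H=\mathbb{R}^n$ and $U=\mathbb{R}^m$ with their Euclidean structures, $(\mathfrak{S},\mathcal{F},\mu)$ is a probability space, and $\mathbb{E}(f)=\int_{\mathfrak{S}}f(\sigma)\,d\mu(\sigma)$. For a square matrix $M$, $E_\alpha(M)=\sum_{k=0}^\infty \frac{M^k}{\Gamma(\alpha k+1)}$ and $E_{\alpha,\alpha}(M)=\sum_{k=0}^\infty \frac{M^k}{\Gamma(\alpha k+\alpha)}$. Here $\partial_t^\alpha$ is the left Caputo derivative $\partial_t^\alpha g(t)=\frac{1}{\Gamma(1-\alpha)}\int_0^t (t-s)^{-\alpha}g'(s)\,ds$. For $x_{0,\sigma}\in H$ and $u\in L^\infty(0,T;U)$ the solution of the system is, for $\mu$-a.e. $\sigma$, $$x_\sigma(t;x_{0,\sigma};u)=E_\alpha(t^\alpha A(\sigma))x_{0,\sigma}+\int_0^t (t-s)^{\alpha-1}E_{\alpha,\alpha}((t-s)^\alpha A(\sigma))B(\sigma)u(s)\,ds,\quad t\in[0,T].$$ The adjoint state with final datum $y_T\in H$ is $y_\sigma(t;y_T)=(T-t)^{\alpha-1}E_{\alpha,\alpha}((T-t)^\alpha A(\sigma)^\top)y_T$, $t\in[0,T)$, and $(I^{1-\alpha}_{T-t}g)(t)=\frac{1}{\Gamma(1-\alpha)}\int_t^T (s-t)^{-\alpha}g(s)\,ds$ is the right Riemann–Liouville integral; $(I^{1-\alpha}_{T-t}y_\sigma)(0;y_T)$ is its value at $t=0$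 for $g=y_\sigma(\cdot;y_T)$. The system is exactly controllable in average in time $T$ if for every $x_{0,\bullet}\in L^1(\mathfrak{S},H;\mu)$ and $x_1\in H$ there exists $u\in L^\infty(0,T;U)$ with $\mathbb{E}(x_\bullet(T;x_{0,\bullet};u))=x_1$. $L^2_{\alpha-1}(0,T;U)$ is the weighted Hilbert space with scalar product $\langle u,v\rangle=\int_0^T (T-s)^{\alpha-1}\langle u(s),v(s)\rangle_U\,ds$. *)

(* Defs.v *)
From HB Require Import structures.
From mathcomp Require Import all_boot all_order all_algebra.
From mathcomp Require Import all_classical all_reals all_analysis.

Set Implicit Arguments.
Unset Strict Implicit.
Unset Printing Implicit Defensive.

Import Order.TTheory GRing.Theory Num.Theory.
Import numFieldNormedType.Exports.

Local Open Scope classical_set_scope.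
Local Open Scope ring_scope.

(* Controls and states are column vectors. The library norm on matrices is the
   sup norm, so the Euclidean structure is introduced here. *)
Definition dotc (R : realType) (k : nat) (x y : 'cV[R]_k) : R :=
  \sum_(i < k) x i ord0 * y i ord0.

Definition normc2 (R : realType) (k : nat) (x : 'cV[R]_k) : R :=
  Num.sqrt (dotc x x).

Definition mxRintegral (d : measure_display) (S : measurableType d)
    (R : realType) (mu : {measure set S -> \bar R}) (D : set S) (k l : nat)
    (f : S -> 'M[R]_(k, l)) : 'M[R]_(k, l) :=
  \matrix_(i, j) \int[mu]_(s in D) f s i j.

Definition mxexpectation (d : measure_display) (S : measurableType d)
    (R : realType) (mu : probability S R) (k l : nat)
    (f : S -> 'M[R]_(k, l)) : 'M[R]_(k, l) :=
  \matrix_(i, j) fine 'E_mu[fun s => f s i j].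

(* In finite dimension, L^p membership does not depend on the norm chosen on
   matrices and amounts to L^p membership of all entries. *)
Definition mxLfun (d : measure_display) (S : measurableType d) (R : realType)
    (mu : {measure set S -> \bar R}) (p : \bar R) (k l : nat)
    (f : S -> 'M[R]_(k, l)) : Prop :=
  forall i j, (fun s => f s i j) \in Lfun mu p.

(* L^oo(0,T;R^m): the values of u outside ]0,T[ are irrelevant, since u is
   replaced there by 0. *)
Definition admissible_control (R : realType) (T : R) (m : nat)
    (u : R -> 'cV[R]_m) : Prop :=
  mxLfun (@lebesgue_measure R) +oo%E (u \_ `]0, T[).

Definition Gamma (R : realType) (x : R) : R :=
  \int[@lebesgue_measure R]_(t in `]0, +oo[) (t `^ (x - 1) * expR (- t)).

(* E_{alpha,beta}(M); the one-parameter function E_alpha is the case beta = 1. *)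
Definition mittag_leffler (R : realType) (alpha beta : R) (n : nat)
    (M : 'M[R]_n) : 'M[R]_n :=
  limn (series (fun k : nat => (Gamma (alpha * k%:R + beta))^-1 *: (M ^+ k))).

(* The solution x_sigma(t; x0; u) of the Caputo system
   d_t^alpha x = A(sigma) x + B(sigma) u, x(0) = x0(sigma), given by the
   variation of constants formula. *)
Definition caputo_solution (R : realType) (alpha : R) (n m : nat) (S : Type)
    (A : S -> 'M[R]_n) (B : S -> 'M[R]_(n, m)) (x0 : S -> 'cV[R]_n)
    (u : R -> 'cV[R]_m) (t : R) (sigma : S) : 'cV[R]_n :=
  mittag_leffler alpha 1 (t `^ alpha *: A sigma) *m x0 sigma +
  mxRintegral (@lebesgue_measure R) `]0, t[ (fun s =>
    (t - s) `^ (alpha - 1) *: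
      (mittag_leffler alpha alpha ((t - s) `^ alpha *: A sigma)
         *m B sigma *m u s)).

Definition steers_in_average (R : realType) (alpha T : R) (n m : nat)
    (d : measure_display) (S : measurableType d) (mu : probability S R)
    (A : S -> 'M[R]_n) (B : S -> 'M[R]_(n, m)) (x0 : S -> 'cV[R]_n)
    (x1 : 'cV[R]_n) (u : R -> 'cV[R]_m) : Prop :=
  mxexpectation mu (caputo_solution alpha A B x0 u T) = x1.

Definition exactly_controllable_in_average (R : realType) (alpha T : R)
    (n m : nat) (d : measure_display) (S : measurableType d)
    (mu : probability S R) (A : S -> 'M[R]_n) (B : S -> 'M[R]_(n, m)) : Prop :=
  forall (x0 : S -> 'cV[R]_n) (x1 : 'cV[R]_n), mxLfun mu 1%E x0 ->
    exists u : R -> 'cV[R]_m,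
      admissible_control T u /\ steers_in_average alpha T mu A B x0 x1 u.

Definition adjoint_state (R : realType) (alpha T : R) (n : nat) (S : Type)
    (A : S -> 'M[R]_n) (yT : 'cV[R]_n) (sigma : S) (t : R) : 'cV[R]_n :=
  (T - t) `^ (alpha - 1) *:
    (mittag_leffler alpha alpha ((T - t) `^ alpha *: (A sigma)^T) *m yT).

(* I^{1-alpha}_{T-t}: the order of integration is 1 - alpha, not alpha. *)
Definition right_RL_integral (R : realType) (alpha T : R) (n : nat)
    (g : R -> 'cV[R]_n) (t : R) : 'cV[R]_n :=
  (Gamma (1 - alpha))^-1 *:
    mxRintegral (@lebesgue_measure R) `]t, T[
      (fun s => (s - t) `^ (- alpha) *: g s).

Definition wL2_dot (R : realType) (alpha T : R) (m : nat)
    (u v : R -> 'cV[R]_m) : R :=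
  \int[@lebesgue_measure R]_(s in `]0, T[)
    ((T - s) `^ (alpha - 1) * dotc (u s) (v s)).

Definition wL2_norm (R : realType) (alpha T : R) (m : nat)
    (u : R -> 'cV[R]_m) : R :=
  Num.sqrt (wL2_dot alpha T u u).

Definition is_min_norm_control (R : realType) (alpha T : R) (n m : nat)
    (d : measure_display) (S : measurableType d) (mu : probability S R)
    (A : S -> 'M[R]_n) (B : S -> 'M[R]_(n, m)) (x0 : S -> 'cV[R]_n)
    (x1 : 'cV[R]_n) (u : R -> 'cV[R]_m) : Prop :=
  [/\ admissible_control T u,
      steers_in_average alpha T mu A B x0 x1 u
    & forall v : R -> 'cV[R]_m, admissible_control T v ->
        steers_in_average alpha T mu A B x0 x1 v ->
        wL2_norm alpha T u <= wL2_norm alpha T v].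

Definition Ja (R : realType) (alpha T : R) (n m : nat)
    (d : measure_display) (S : measurableType d) (mu : probability S R)
    (A : S -> 'M[R]_n) (B : S -> 'M[R]_(n, m)) (x0 : S -> 'cV[R]_n)
    (x1 yT : 'cV[R]_n) : R :=
  2^-1 * \int[@lebesgue_measure R]_(t in `]0, T[)
    ((T - t) `^ (1 - alpha) *
      normc2 (mxexpectation mu (fun sigma =>
        (B sigma)^T *m adjoint_state alpha T A yT sigma t)) ^+ 2)
  - dotc x1 yT
  + fine 'E_mu[fun sigma => dotc (x0 sigma)
      (right_RL_integral alpha T (adjoint_state alpha T A yT sigma) 0)].

Definition is_minimizer_Ja (R : realType) (alpha T : R) (n m : nat)
    (d : measure_display) (S : measurableType d) (mu : probability S R)
    (A : S -> 'M[R]_n) (B : S -> 'M[R]_(n, m)) (x0 : S -> 'cV[R]_n)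
    (x1 yT : 'cV[R]_n) : Prop :=
  forall y : 'cV[R]_n,
    Ja alpha T mu A B x0 x1 yT <= Ja alpha T mu A B x0 x1 y.

Definition ua (R : realType) (alpha T : R) (n m : nat)
    (d : measure_display) (S : measurableType d) (mu : probability S R)
    (A : S -> 'M[R]_n) (B : S -> 'M[R]_(n, m)) (yT : 'cV[R]_n)
    (t : R) : 'cV[R]_m :=
  mxexpectation mu (fun sigma => (B sigma)^T *m
    mittag_leffler alpha alpha ((T - t) `^ alpha *: (A sigma)^T)) *m yT.

(* Main.v *)
Require Import Defs.
From HB Require Import structures.
From mathcomp Require Import all_boot all_order all_algebra.
From mathcomp Require Import all_classical all_reals all_analysis.
From mathcomp Require Import measurable_realfun ess_sup_inf ring lra.

Set Implicit Arguments.
Unset Strict Implicit.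
Unset Printing Implicit Defensive.

Import Order.TTheory GRing.Theory Num.Theory.
Import numFieldNormedType.Exports.

Local Open Scope classical_set_scope.
Local Open Scope ring_scope.

(** Every Mittag-Leffler expression is a power series
    [sum_k c_k (T - s)^(alpha k) A^k] whose coefficients [c_k = 1 / Gamma] decay
    faster than any geometric sequence, so expectations and time integrals are
    computed term by term by dominated convergence. Euler's Beta integral then
    shows that the fractional integral of the adjoint state at time [0] is
    [E_alpha(T^alpha A^T) y]. With [Phi(t) = E(E_(alpha,alpha)((T - t)^alpha A) B)],
    a control [u] steers in average from [x0] to [x1] iff [L u = b], where [L u] is
    the integral of [(T - t)^(alpha - 1) Phi(t) u(t)] and [b] is [x1] minus the
    averaged free evolution. Since [L] is the adjoint of [y |-> u_a = Phi(t)^T y]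
    for the weighted scalar product, the functional is
    [<y, G y> / 2 - <b, y>] with the Gramian [G y = L (Phi^T y)], which
    controllability makes invertible. Its unique minimizer solves [G y = b], and
    minimality and uniqueness of [u_a] follow from
    [<u_a, v> = <y, L v> = <y, b>] for every admissible [v] (Pythagoras). *)

(** * Affine substitution for Lebesgue integrals and the convolution of Gamma integrands *)

Section EulerIntegrals.
Context {R : realType}.
Local Notation leb := (@lebesgue_measure R).

(** Lebesgue measure is determined by its values on bounded half-open intervals, and the preimage of
    such an interval has its length divided by [a]. *)
Lemma lebesgue_measure_affine (a b : R) (A : set R) : 0 < a -> measurable A ->
  (a%:E * pushforward leb (fun x : measurableTypeR R => (a * x + b)%R : measurableTypeR R) A)%E
  = leb A.
Proof.
move=> a0 mA.
have mf : measurable_fun [set: measurableTypeR R]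
    (fun x : measurableTypeR R => a * x + b : measurableTypeR R).
  by apply: measurable_funD => //; exact: measurable_funM.
pose phi := HB.pack_for {mfun measurableTypeR R >-> measurableTypeR R}
  (fun x : measurableTypeR R => a * x + b : measurableTypeR R)
  (isMeasurableFun.Build _ _ _ _ _ mf).
have -> // := @lebesgue_measure_unique R (mscale (NngNum (ltW a0)) (pushforward leb phi)).
move=> _ [[x y]] _ <-.
rewrite [RHS](_ : _ =
    (a%:E * leb [set` `](x - b)%R / a, (y - b)%R / a]%R])%E); last first.
  congr (_ * leb _)%E; apply/seteqP; split=> z /=;
  by rewrite !in_itv/= ltr_pdivrMr// ler_pdivlMr// ltrBlDr lerBrDr mulrC.
rewrite !lebesgue_measure_itv/= !lte_fin ltr_pM2r ?invr_gt0// ltrD2r.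
case: ifP => // _; last by rewrite mule0.
by rewrite -!EFinD -EFinM; congr EFin; field; rewrite gt_eqF.
Qed.

Lemma ge0_integral_affine (a b : R) (f : R -> \bar R) : 0 < a ->
  measurable_fun [set: R] f -> (forall x, 0 <= f x)%E ->
  (\int[leb]_x f x = a%:E * \int[leb]_x f (a * x + b)%R)%E.
Proof.
move=> a0 mf f0.
have mphi : measurable_fun [set: measurableTypeR R]
    (fun x : measurableTypeR R => a * x + b : measurableTypeR R).
  by apply: measurable_funD => //; exact: measurable_funM.
pose phi := HB.pack_for {mfun measurableTypeR R >-> measurableTypeR R}
  (fun x : measurableTypeR R => a * x + b : measurableTypeR R)
  (isMeasurableFun.Build _ _ _ _ _ mphi).
have := @ge0_integral_pushforward _ _ _ _ _ phi mphi leb setT f measurableT mf.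
rewrite preimage_setT => <- //.
rewrite -(@ge0_integral_mscale _ _ _ (pushforward leb phi) setT measurableT (NngNum (ltW a0)) f)//.
by apply: eq_measure_integral => A mA _; exact/esym/lebesgue_measure_affine.
Qed.

Lemma erestrict_itvE (f : R -> \bar R) (i : interval R) (x : R) :
  (f \_ [set` i]) x = if x \in i then f x else 0%E.
Proof. by rewrite patchE mem_setE. Qed.

Let gam (a x : R) := x `^ (a - 1) * expR (- x).
(** The parameter [r] is the value of the sum of two Gamma variables in the convolution below;
    [r = 1] gives the usual Beta integrand. *)
Let bet (a b r x : R) := x `^ (a - 1) * (r - x) `^ (b - 1).

Let mgam a (D : set R) : measurable_fun D (gam a).
Proof.
apply: measurable_funTS; apply: measurable_funM => //.
by apply: measurableT_comp => //; exact: measurableT_comp.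
Qed.

Let mbet a b r (D : set R) : measurable_fun D (bet a b r).
Proof.
apply: measurable_funTS; apply: measurable_funM => //.
apply: (@measurableT_comp _ _ _ _ _ _ (@powR R ^~ (b - 1))) => //.
by apply: measurable_funB.
Qed.

(** Substitute [x = r t]: the powers contribute the exponents [a - 1] and [b - 1], and [dx] one
    more. *)
Lemma beta_integral_scale (a b r : R) : 0 < r ->
  (\int[leb]_(x in `]0%R, r[) (bet a b r x)%:E =
   (r `^ (a + b - 1))%:E * \int[leb]_(x in `]0%R, 1%R[) (bet a b 1 x)%:E)%E.
Proof.
move=> r0; rewrite integral_mkcond (ge0_integral_affine 0 r0); last 2 first.
- by apply/(measurable_restrictT _ _).1 => //; apply/measurable_EFinP; exact: mbet.
- by apply: erestrict_ge0 => x _; rewrite lee_fin mulr_ge0 ?powR_ge0.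
rewrite -[in RHS]ge0_integralZl_EFin ?powR_ge0//; last 2 first.
- by move=> x _; rewrite lee_fin mulr_ge0 ?powR_ge0.
- apply/measurable_EFinP; exact: mbet.
rewrite [RHS]integral_mkcond -[LHS]ge0_integralZl_EFin ?(ltW r0)//; last 2 first.
- by move=> x _; apply: erestrict_ge0 => {}x _; rewrite lee_fin mulr_ge0 ?powR_ge0.
- apply: (@measurableT_comp _ _ _ _ _ _ ((fun x => (bet a b r x)%:E) \_ `]0%R, r[)).
    by apply/(measurable_restrictT _ _).1 => //; apply/measurable_EFinP; exact: mbet.
  by apply: measurable_funD => //; exact: measurable_funM.
apply: eq_integral => x _; rewrite addr0 !erestrict_itvE !in_itv/=.
rewrite pmulr_rgt0// gtr_pMr//; case: ifPn => [/andP[x0 x1]|]; last by rewrite mule0.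
rewrite -!EFinM; congr EFin; rewrite /bet -{3}(mulr1 r) -mulrBr !powRM ?(ltW r0) ?(ltW x0) ?subr_ge0 ?(ltW x1)//.
have r0' : r != 0 by rewrite gt_eqF.
have -> : r `^ (a + b - 1) = r * r `^ (a - 1) * r `^ (b - 1).
  rewrite -{2}(powRr1 (ltW r0)) -!powRD ?r0' ?implybT//; congr powR; ring.
ring.
Qed.

(** Both sides are the double integral over [0 < x < r] of [x^(a-1) (r-x)^(b-1) e^(-r)], where [r]
    is the sum of the two Gamma variables; Tonelli exchanges the orders. The identity holds in the
    extended reals, and finiteness is settled later. *)
Lemma gamma_beta_convolution (a b : R) :
  ((\int[leb]_(x in `]0%R, +oo[) (gam a x)%:E) * (\int[leb]_(x in `]0%R, +oo[) (gam b x)%:E) =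
   (\int[leb]_(x in `]0%R, 1%R[) (bet a b 1 x)%:E) * \int[leb]_(x in `]0%R, +oo[) (gam (a + b) x)%:E)%E.
Proof.
pose G c := ((fun x => (gam c x)%:E) \_ `]0%R, +oo[).
have mG c : measurable_fun [set: R] (G c).
  by apply/(measurable_restrictT _ _).1 => //; apply/measurable_EFinP; exact: mgam.
have G0 c x : (0 <= G c x)%E.
  by apply: erestrict_ge0 => {}x _; rewrite lee_fin mulr_ge0 ?powR_ge0 ?expR_ge0.
have iG c : (\int[leb]_(x in `]0%R, +oo[) (gam c x)%:E = \int[leb]_x G c x)%E.
  exact: integral_mkcond.
rewrite !iG.
pose f (z : R * R) := (G a z.1 * G b (z.2 - z.1)%R)%E.
have mf : measurable_fun [set: R * R] f.
  apply: emeasurable_funM; apply: measurableT_comp => //.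
  exact: measurable_funB.
have f0 z : (0 <= f z)%E by rewrite mule_ge0.
have EB0 : (0 <= \int[leb]_(x in `]0%R, 1%R[) (bet a b 1 x)%:E)%E.
  by apply: integral_ge0 => x _; rewrite lee_fin mulr_ge0 ?powR_ge0.
transitivity (\int[leb]_x \int[leb]_y f (x, y))%E; last first.
  rewrite (@fubini_tonelli _ _ _ _ _ leb leb f mf f0) -ge0_integralZl//; last exact: mG.
  apply: eq_integral => r _; rewrite /f/=.
  (* For [r <= 0] the numbers [x] and [r - x] are never both positive, so both sides vanish. *)
  have [r0|r0] := ltP 0 r; last first.
    rewrite integral0_eq.
      by rewrite /G erestrict_itvE in_itv/= andbT ltNge r0 mule0.
    move=> x _; rewrite /G !erestrict_itvE !in_itv/= !andbT.
    case: ifPn => x0; last by rewrite mul0e.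
    by rewrite ifF ?mule0// subr_gt0; apply/negP => /(lt_trans x0); rewrite ltNge r0.
  transitivity (\int[leb]_(x in `]0%R, r[) ((expR (- r))%:E * (bet a b r x)%:E))%E.
    rewrite [RHS]integral_mkcond; apply: eq_integral => x _.
    rewrite /G !erestrict_itvE !in_itv/= !andbT subr_gt0.
    case: (ltP 0 x) => x0; last by rewrite mul0e.
    case: (ltP x r) => xr /=; last by rewrite mule0.
    rewrite -!EFinM; congr EFin; rewrite /gam /bet.
    have -> : expR (- r) = expR (- x) * expR (- (r - x)) by rewrite -expRD; congr expR; ring.
    ring.
  rewrite ge0_integralZl_EFin ?expR_ge0//; last 2 first.
  - by move=> x _; rewrite lee_fin mulr_ge0 ?powR_ge0.
  - by apply/measurable_EFinP; exact: mbet.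
  rewrite beta_integral_scale// muleA muleC; congr (_ * _)%E.
  by rewrite /G erestrict_itvE in_itv/= r0/= /gam -EFinM mulrC.
have Gb0 : (0 <= \int[leb]_x G b x)%E by exact: integral_ge0.
(* In the other order, translation invariance in the sum variable separates the two factors. *)
transitivity (\int[leb]_x (G a x * \int[leb]_y G b y))%E.
  by rewrite ge0_integralZr//; exact: mG.
apply: eq_integral => s _; rewrite /f/= ge0_integralZl//.
  congr (_ * _)%E; rewrite (ge0_integral_affine (- s) ltr01 (mG b))// mul1e.
  by apply: eq_integral => x _; rewrite mul1r.
apply: (@measurableT_comp _ _ _ _ _ _ (G b)); first exact: mG.
exact: measurable_funB.
Qed.

End EulerIntegrals.

(** * Finiteness and growth of the Gamma function, and Euler's Beta integral *)

Section GammaFunction.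
Context {R : realType}.
Local Notation leb := (@lebesgue_measure R).

(** The integrand may be unbounded at 0, so the fundamental theorem of calculus with primitive
    [x^a / a] is applied away from 0, and monotone convergence passes to the limit. *)
Lemma powR_integral01 (a : R) : 0 < a ->
  (\int[leb]_(x in `]0%R, 1%R]) (x `^ (a - 1))%:E <= (a^-1)%:E)%E.
Proof.
(* The shift to [i.+2] keeps the left endpoint strictly below 1, so every interval is
   nondegenerate. *)
move=> a0; pose F (i : nat) : set R := `[i.+2%:R^-1, 1%R]%classic.
have -> : `]0%R, 1%R]%classic = \bigcup_i F i.
  apply/seteqP; split => x /=.
    rewrite in_itv/= => /andP[x0 x1]; have [N Nx] := ltr_add_invr x0.
    exists N => //; rewrite /F/= in_itv/= x1 andbT.
    rewrite add0r in Nx.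
    by apply: le_trans (ltW Nx); rewrite lef_pV2 ?posrE ?ltr0n// ler_nat.
  move=> [N _]; rewrite /F/= !in_itv/= => /andP[Nx ->]; rewrite andbT.
  by apply: lt_le_trans Nx; rewrite invr_gt0 ltr0n.
have ndF : nondecreasing_seq F.
  move=> i j ij; apply/subsetPset => x; rewrite /F/= !in_itv/= => /andP[ix ->].
  by rewrite andbT (le_trans _ ix)// lef_pV2 ?posrE ?ltr0n// ler_nat !ltnS.
have cF : ((\int[leb]_(x in F i) (x `^ (a - 1))%:E) @[i --> \oo] -->
    \int[leb]_(x in \bigcup_i F i) (x `^ (a - 1))%:E)%E.
  apply: ge0_nondecreasing_set_cvg_integral => //.
  - by move=> i; exact: measurable_itv.
  - by move=> i; apply/measurable_EFinP/measurable_funTS.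
  - by move=> i x _; rewrite lee_fin powR_ge0.
rewrite -(cvg_lim _ cF)//; apply: lime_le; first by apply/cvg_ex; eexists; exact: cF.
apply: nearW => i.
have i0 : 0 < i.+2%:R^-1 :> R by rewrite invr_gt0.
have i1 : i.+2%:R^-1 < 1 :> R by rewrite invf_lt1 ?ltr0n// ltr1n.
have drv (x : R) : 0 < x -> is_derive x 1 (fun y : R => a^-1 * y `^ a) (x `^ (a - 1)).
  move=> x0; have /is_derive_eq := is_deriveZ a^-1 (is_derive1_powR a x0); apply.
  by rewrite /GRing.scale/= mulrA mulVf ?gt_eqF// mul1r.
have drv' (x : R) : 0 < x -> derivable (fun y : R => a^-1 * y `^ a) x 1.
  by move=> x0; have [] := drv _ x0.
have cpow (c x : R) : 0 < x -> {for x, continuous (fun y : R => y `^ c)}.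
  by move=> x0; apply/differentiable_continuous/derivable1_diffP;
      have [] := is_derive1_powR c x0.
rewrite (@continuous_FTC2 _ _ (fun y => a^-1 * y `^ a))//.
- by rewrite -EFinB lee_fin powR1 mulr1 gerBl mulr_ge0 ?powR_ge0// invr_ge0 ltW.
- apply: derivable_within_continuous => x; rewrite in_itv/= => /andP[ix _].
  by have [] := is_derive1_powR (a - 1) (lt_le_trans i0 ix).
- split.
  + by move=> x; rewrite in_itv/= => /andP[ix _]; apply: drv'; exact: lt_trans ix.
  + by apply: cvg_at_right_filter; apply: cvgM; [exact: cvg_cst|exact: cpow].
  + by apply: cvg_at_left_filter; apply: cvgM; [exact: cvg_cst|exact: cpow].
- move=> x; rewrite in_itv/= => /andP[ix _].
  by rewrite derive1E; have /(@derive_val _ _ _ _ _ _ _) -> := drv x (lt_trans i0 ix).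
Qed.

(** On []0, 1]] the exponential is at most 1 and the power is integrable; beyond 1, half of the
    exponential decay absorbs the power, which leaves a multiple of the exponential density of rate
    1/2. *)
Lemma integrable_gamma (a : R) : 0 < a ->
  leb.-integrable `]0%R, +oo[ (fun x => (x `^ (a - 1) * expR (- x))%:E).
Proof.
(* [C] is the constant in [a ln x <= x / 2 + a ln (2a)], which comes from [ln z <= z] at
   [z = x / (2a)]. The factor 2 in [f] cancels the normalization of the density. *)
move=> a0; pose C := expR (a * ln (2 * a)).
pose p : R -> R := (fun x : R => x `^ (a - 1)) \_ `]0, 1].
pose f (x : R) : R := p x + C * 2 * exponential_pdf 2^-1 x.
have ige : leb.-integrable setT (EFin \o f).
  rewrite (_ : EFin \o f = (EFin \o p) \+ (fun x => (C * 2)%:E * (EFin \o exponential_pdf 2^-1) x))%E.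
    apply: integrableD => //; last first.
      by apply: integrableZl => //; apply: integrable_exponential_pdf; rewrite invr_gt0.
    rewrite /p -restrict_EFin; refine (proj1 (integrable_mkcond _ _) _);
        first exact: measurable_itv.
    apply/integrableP; split.
      by apply/measurable_EFinP/measurable_funTS.
    apply: le_lt_trans (ltry a^-1).
    under eq_integral do rewrite /= ger0_norm ?powR_ge0//.
    exact: powR_integral01.
  by apply/funext => x.
apply: (le_integrable _ _ _ (integrableS measurableT _ (@subsetT _ _) ige)) => //.
  apply/measurable_EFinP/measurable_funTS/measurable_funM => //.
  by apply: measurableT_comp => //; exact: measurableT_comp.
move=> x /=; rewrite in_itv/= andbT => x0; rewrite lee_fin.
rewrite ger0_norm ?mulr_ge0 ?powR_ge0 ?expR_ge0//; apply: le_trans (ler_norm _).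
rewrite /f /p exponential_pdfE ?(ltW x0)// patchE; case: ifPn => x1.
  rewrite -[leLHS]addr0 lerD ?mulr_ge0 ?expR_ge0// ?invr_ge0//.
  by rewrite ger_pMr ?powR_gt0// expR_le1 oppr_le0 ltW.
have {}x1 : 1 < x.
  by move: x1; rewrite mem_setE in_itv/= x0/= -ltNge.
rewrite add0r /powR gt_eqF// mulrA mulfK ?pnatr_eq0// -!expRD ler_expR.
have h : ln x <= x / (2 * a) + ln (2 * a).
  have a2 : 0 < 2 * a by rewrite mulr_gt0.
  have -> : ln x = ln (x / (2 * a)) + ln (2 * a).
    by rewrite -lnM ?posrE ?divr_gt0// divfK// gt_eqF.
  by rewrite lerD2r ltW// ln_sublinear// divr_gt0.
have lx : 0 <= ln x by rewrite ln_ge0// ltW.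
have : a * ln x <= a * (x / (2 * a) + ln (2 * a)) by rewrite ler_wpM2l// ltW.
rewrite mulrDr.
have -> : a * (x / (2 * a)) = x / 2 by field; rewrite gt_eqF.
lra.
Qed.

Lemma EFin_Gamma (a : R) : 0 < a ->
  ((Gamma a)%:E = \int[leb]_(x in `]0%R, +oo[) (x `^ (a - 1) * expR (- x))%:E)%E.
Proof.
move=> a0; rewrite /Gamma fineK//; apply: integrable_fin_num => //.
exact: integrable_gamma.
Qed.

(* The integrand of Gamma is at least N^a e^-(N+1) / (N+1) on [N, N+1]. *)
Lemma Gamma_ge (a N : R) : 0 < a -> 1 <= N ->
  N `^ a * (expR (- (N + 1)) / (N + 1)) <= Gamma a.
Proof.
move=> a0 N1; have N0 : 0 < N by apply: lt_le_trans N1.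
rewrite -lee_fin EFin_Gamma//.
have mg (D : set R) : measurable_fun D (fun x : R => x `^ (a - 1) * expR (- x)).
  apply/measurable_funTS/measurable_funM => //.
  by apply: measurableT_comp => //; exact: measurableT_comp.
apply: (@le_trans _ _ (\int[leb]_(x in `[N, (N + 1)%R]) (x `^ (a - 1) * expR (- x))%:E)%E);
    last first.
  apply: ge0_subset_integral => //; first by apply/measurable_EFinP; exact: mg.
    by move=> x _; rewrite lee_fin mulr_ge0 ?powR_ge0 ?expR_ge0.
  by move=> x /=; rewrite !in_itv/= andbT => /andP[Nx _]; exact: lt_le_trans Nx.
apply: (@le_trans _ _ (\int[leb]_(x in `[N, (N + 1)%R]) (N `^ a * (expR (- (N + 1)) / (N + 1)))%:E)%E).
  rewrite integral_cst//= lebesgue_measure_itv/= lte_fin ltrDl ltr01.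
  by rewrite -EFinB addrAC subrr add0r mule1.
apply: ge0_le_integral => //.
- by move=> x _; rewrite lee_fin !mulr_ge0 ?powR_ge0 ?expR_ge0// invr_ge0; lra.
- by apply/measurable_EFinP; exact: mg.
- move=> x; rewrite /= in_itv/= => /andP[Nx xN]; rewrite lee_fin.
  have x0 : 0 < x by apply: lt_le_trans Nx.
  have -> : x `^ (a - 1) = x `^ a / x.
    by rewrite powRB ?powRr1 ?(ltW x0)//; apply/implyP => _; rewrite gt_eqF.
  rewrite -[leRHS]mulrA; apply: ler_pM; rewrite ?divr_ge0 ?powR_ge0 ?expR_ge0//; first lra.
    by apply: ge0_ler_powR; rewrite ?nnegrE//; lra.
  rewrite mulrC; apply: ler_pM; rewrite ?expR_ge0 ?invr_ge0//; first lra.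
    by rewrite lef_pV2 ?posrE//; lra.
  by rewrite ler_expR; lra.
Qed.

Lemma Gamma_gt0 (a : R) : 0 < a -> 0 < Gamma a.
Proof.
move=> a0; apply: lt_le_trans (Gamma_ge a0 (lexx 1)).
by rewrite mulr_gt0 ?powR_gt0 ?divr_gt0 ?expR_gt0.
Qed.

Lemma beta_integral (a b r : R) : 0 < a -> 0 < b -> 0 < r ->
  (\int[leb]_(x in `]0%R, r[) (x `^ (a - 1) * (r - x) `^ (b - 1))%:E =
   (r `^ (a + b - 1) * (Gamma a * Gamma b / Gamma (a + b)))%:E)%E.
Proof.
move=> a0 b0 r0; rewrite beta_integral_scale// [RHS]EFinM; congr (_ * _)%E.
have := gamma_beta_convolution a b; rewrite -!EFin_Gamma ?addr_gt0//.
have G0 := Gamma_gt0 (addr_gt0 a0 b0).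
set B := (\int[_]_(_ in _) _)%E.
have B0 : (0 <= B)%E.
  by apply: integral_ge0 => x _; rewrite lee_fin mulr_ge0 ?powR_ge0.
(* An infinite Beta integral is excluded: times the positive [Gamma (a + b)] it would stay infinite,
   while the product of the two Gamma values is finite. *)
case: B B0 => [B| |] // _; last by rewrite mulyr gtr0_sg// mul1e.
by rewrite -!EFinM => -[->]; rewrite mulfK// gt_eqF.
Qed.

End GammaFunction.

(** * Mittag-Leffler series: decay of the coefficients and entrywise convergence *)

Section MittagLeffler.
Context {R : realType}.
Implicit Types alpha beta : R.

Definition ml_coef alpha beta (k : nat) : R := (Gamma (alpha * k%:R + beta))^-1.

Lemma ml_arg_gt0 alpha beta k : 0 < alpha -> 0 < beta -> 0 < alpha * k%:R + beta.
Proof. by move=> a0 b0; rewrite ltr_wpDl// mulr_ge0// ltW. Qed.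

Lemma ml_coef_gt0 alpha beta k : 0 < alpha -> 0 < beta -> 0 < ml_coef alpha beta k.
Proof. by move=> a0 b0; rewrite invr_gt0 Gamma_gt0// ml_arg_gt0. Qed.

(** With [N^alpha = b], the lower bound [Gamma_ge] yields [Gamma (alpha k + beta) >= b^k E], so the
    terms are at most [(C / b)^k / E]. *)
Lemma ml_coef_geometric alpha beta C : 0 < alpha -> 0 < beta -> 0 <= C ->
  exists2 D, 0 <= D & forall k, ml_coef alpha beta k * C ^+ k <= geometric D 2^-1 k.
Proof.
(* The base [2 C + 1] ensures [C / b <= 1/2], and also [b >= 1], hence [N >= 1] as [Gamma_ge]
   demands. *)
move=> a0 b0 C0; pose b : R := 2 * C + 1; pose N := b `^ alpha^-1.
have b1 : 1 <= b by rewrite /b; lra.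
have N1 : 1 <= N by rewrite /N -(powRr0 b) ler_powR// invr_ge0 ltW.
have Na : N `^ alpha = b by rewrite /N -powRrM mulVf ?gt_eqF// powRr1//; lra.
pose E := expR (- (N + 1)) / (N + 1).
have E0 : 0 < E by rewrite divr_gt0 ?expR_gt0//; lra.
exists E^-1; first by rewrite invr_ge0 ltW.
move=> k; rewrite /geometric/= /ml_coef.
have G := Gamma_ge (ml_arg_gt0 k a0 b0) N1; rewrite -/E in G.
have bk : b ^+ k * E <= Gamma (alpha * k%:R + beta).
  apply: le_trans G; rewrite ler_pM2r// powRD; last first.
    by apply/implyP => _; rewrite gt_eqF//; lra.
  rewrite powRrM Na powR_mulrn; last lra.
  rewrite ler_peMr ?exprn_ge0//; first lra.
  by rewrite -(powRr0 N) ler_powR// ltW.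
have bk0 : 0 < b ^+ k * E by rewrite mulr_gt0// exprn_gt0//; lra.
apply: (@le_trans _ _ ((b ^+ k * E)^-1 * C ^+ k)).
  by rewrite ler_wpM2r ?exprn_ge0// lef_pV2 ?posrE ?(lt_le_trans bk0).
rewrite invfM mulrAC [leRHS]mulrC ler_pM2r ?invr_gt0// -exprVn -exprMn.
have b_gt0 : 0 < b by lra.
apply: lerXn2r; rewrite ?nnegrE ?mulr_ge0 ?invr_ge0 ?(ltW b_gt0)//.
by rewrite mulrC ler_pdivrMr// /b; lra.
Qed.

(** The growth of the entries of [A ^+ k *m B]. It is always beaten by the Mittag-Leffler
    coefficients. *)
Definition geo_bounded (q : nat -> R) :=
  exists K C, [/\ 0 <= K, 0 <= C & forall k, `|q k| <= K * C ^+ k].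

Lemma cvg_sumr (I : finType) (f : I -> nat -> R) (l : I -> R) :
  (forall i, f i @ \oo --> l i) -> (fun n => \sum_i f i n) @ \oo --> \sum_i l i.
Proof. by move=> fl; apply: cvg_big => //; exact: add_continuous. Qed.

Lemma cvg_series_sumr (I : finType) (f : I -> nat -> R) (l : I -> R) :
  (forall i, series (f i) @ \oo --> l i) ->
  series (fun n => \sum_i f i n) @ \oo --> \sum_i l i.
Proof.
move=> fl; rewrite (_ : series _ = fun n => \sum_i series (f i) n); first exact: cvg_sumr.
by apply/funext => n; rewrite /series/= exchange_big.
Qed.

(** The constant [D] is uniform in [h], [q] and [k]; this supplies the dominating functions both in
    time and in [sigma]. It comes from [ml_coef_geometric] at the ratio [Y C]. *)
Lemma ml_term_majorant alpha beta (K C Y : R) :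
  0 < alpha -> 0 < beta -> 0 <= K -> 0 <= C -> 0 <= Y ->
  exists2 D, 0 <= D & forall h q k, 0 <= h <= Y -> `|q| <= K * C ^+ k ->
    `|ml_coef alpha beta k * h ^+ k * q| <= geometric D 2^-1 k.
Proof.
move=> a0 b0 K0 C0 Y0.
have [D D0 Db] := ml_coef_geometric a0 b0 (mulr_ge0 Y0 C0).
exists (K * D); first exact: mulr_ge0.
move=> h q k /andP[h0 hY] qb; rewrite /geometric/= -[leRHS]mulrA.
apply: le_trans (ler_wpM2l K0 (Db k)).
have c0 := ltW (ml_coef_gt0 k a0 b0).
rewrite !normrM normrX (ger0_norm h0) (ger0_norm c0).
rewrite mulrCA -[leLHS]mulrA ler_wpM2l// exprMn mulrCA.
by apply: ler_pM; rewrite ?exprn_ge0// lerXn2r// nnegrE.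
Qed.

Lemma cvgn_geometric_half (D : R) : cvgn (series (geometric D 2^-1)).
Proof. by apply: is_cvg_geometric_series; rewrite ger0_norm ?invr_ge0// invf_lt1 ?ltr1n. Qed.

Lemma cvgn_geo_bounded alpha beta (q : nat -> R) :
  0 < alpha -> 0 < beta -> geo_bounded q ->
  cvgn (series (fun k => ml_coef alpha beta k * q k)).
Proof.
move=> a0 b0 [K [C [K0 C0 qb]]].
have [D D0 Db] := ml_term_majorant a0 b0 K0 C0 ler01.
apply: normed_cvg; apply: (@series_le_cvg _ _ (geometric D 2^-1)).
- by move=> k; exact: normr_ge0.
- by move=> k; rewrite /geometric/= mulr_ge0// exprn_ge0// invr_ge0.
- by move=> k /=; have := Db 1 (q k) k; rewrite ler01 lexx expr1n mulr1; apply.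
- exact: cvgn_geometric_half.
Qed.

Lemma mulmx_bound (m n p : nat) (a b : R) (A : 'M[R]_(m, n)) (B : 'M[R]_(n, p)) :
  0 <= a ->
  (forall i j, `|A i j| <= a) -> (forall i j, `|B i j| <= b) ->
  forall i j, `|(A *m B) i j| <= n%:R * a * b.
Proof.
move=> a0 Aa Bb i j; rewrite mxE; apply: le_trans (ler_norm_sum _ _ _) _.
rewrite -mulrA mulr_natl -[X in _ *+ X]card_ord -sumr_const; apply: ler_sum => l _.
by rewrite normrM ler_pM.
Qed.

Lemma expmx_bound (n : nat) (a : R) (A : 'M[R]_n) : 0 <= a ->
  (forall i j, `|A i j| <= a) ->
  forall k i j, `|(A ^+ k) i j| <= (n%:R * a) ^+ k.
Proof.
move=> a0 Aa; elim=> [|k IH] i j.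
  by rewrite !expr0 mxE; case: (i == j); rewrite ?normr1 ?normr0.
by rewrite !exprS; exact: mulmx_bound.
Qed.

Lemma mx_entry_bounded (m n : nat) (A : 'M[R]_(m, n)) :
  exists2 a, 0 <= a & forall i j, `|A i j| <= a.
Proof.
exists (\sum_i \sum_j `|A i j|) => [|i j].
  by apply: sumr_ge0 => i _; apply: sumr_ge0.
rewrite (bigD1 i)//= (bigD1 j)//= -addrA lerDl addr_ge0 ?sumr_ge0// => k _.
exact: sumr_ge0.
Qed.

Lemma geo_bounded_expmx_mul (n m : nat) (A : 'M[R]_n) (B : 'M[R]_(n, m)) i j :
  geo_bounded (fun k => (A ^+ k *m B) i j).
Proof.
have [a a0 Aa] := mx_entry_bounded A; have [b b0 Bb] := mx_entry_bounded B.
exists (n%:R * b), (n%:R * a); split; rewrite ?mulr_ge0// => k.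
rewrite mulrAC; apply: mulmx_bound => //; first by rewrite exprn_ge0// mulr_ge0.
exact: expmx_bound.
Qed.

Lemma cvg_mx_entry (m n : nat) (f : nat -> 'M[R]_(m, n)) (L : 'M[R]_(m, n)) :
  (forall i j, (fun k => f k i j) @ \oo --> L i j) -> f @ \oo --> L.
Proof.
move=> fL; apply/cvg_ballP => e e0; near=> k; split=> // i j.
move: i j; near: k; apply: filter_forall => i; apply: filter_forall => j.
by have /cvg_ballP := fL i j; apply.
Unshelve. all: by end_near. Qed.

(** [mittag_leffler] is a [limn], meaningful only once convergence is known: each entry series
    converges by the geometric growth of powers, and the entry limits assemble into the matrix
    limit. *)
Lemma mittag_leffler_entry alpha beta (n : nat) (M : 'M[R]_n) i j :
  0 < alpha -> 0 < beta ->
  series (fun k => ml_coef alpha beta k * (M ^+ k) i j) @ \oo -->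
    mittag_leffler alpha beta M i j.
Proof.
move=> a0 b0; pose s i j := series (fun k => ml_coef alpha beta k * (M ^+ k) i j).
have cs i' j' : cvgn (s i' j').
  apply: cvgn_geo_bounded => //; have := geo_bounded_expmx_mul M 1%:M i' j'.
  by under eq_fun do rewrite mulmx1.
rewrite (_ : mittag_leffler alpha beta M = \matrix_(i, j) limn (s i j)).
  by rewrite mxE; exact: cs.
apply/cvg_lim; first exact: norm_hausdorff.
apply: cvg_mx_entry => i' j'; rewrite mxE.
rewrite (_ : (fun _ => _) = s i' j'); first exact: cs.
apply/funext => N; rewrite /s /series/= summxE; apply: eq_bigr => k _.
by rewrite mxE.
Qed.

Lemma trmx_exp (n : nat) (M : 'M[R]_n) k : (M ^+ k)^T = M^T ^+ k.
Proof.
elim: k => [|k IH]; first by rewrite !expr0 trmx1.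
by rewrite exprS exprSr -IH -!mulmxE trmx_mul.
Qed.

Lemma scalemx_exp (n : nat) (a : R) (M : 'M[R]_n) k : (a *: M) ^+ k = a ^+ k *: M ^+ k.
Proof.
elim: k => [|k IH]; first by rewrite !expr0 scale1r.
by rewrite !exprS IH -!mulmxE -scalemxAl -scalemxAr scalerA.
Qed.

Lemma mittag_leffler_tr alpha beta (n : nat) (M : 'M[R]_n) :
  0 < alpha -> 0 < beta ->
  mittag_leffler alpha beta M^T = (mittag_leffler alpha beta M)^T.
Proof.
move=> a0 b0; apply/matrixP => i j; rewrite [RHS]mxE.
rewrite -(cvg_lim _ (@mittag_leffler_entry _ _ _ M j i a0 b0))//.
rewrite -(cvg_lim _ (@mittag_leffler_entry _ _ _ M^T i j a0 b0))//.
congr (limn (series _)); apply/funext => k.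
by rewrite -trmx_exp [in LHS]mxE.
Qed.

(** The form separates variables: time will enter through [h ^+ k] only and the random parameter
    through [M ^+ k *m B] only, so the two integrations act on different factors of each term. *)
Lemma mittag_leffler_mul_entry alpha beta (n m : nat) (h : R) (M : 'M[R]_n)
    (B : 'M[R]_(n, m)) i j :
  0 < alpha -> 0 < beta ->
  series (fun k => ml_coef alpha beta k * h ^+ k * (M ^+ k *m B) i j) @ \oo -->
    (mittag_leffler alpha beta (h *: M) *m B) i j.
Proof.
move=> a0 b0; rewrite mxE.
rewrite (_ : (fun k => _) = fun k => \sum_l ml_coef alpha beta k * ((h *: M) ^+ k) i l * B l j).
  apply: cvg_series_sumr => l.
  rewrite (_ : series _ = (fun N => series (fun k => ml_coef alpha beta k * ((h *: M) ^+ k) i l) N * B l j)).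
    by apply: cvgM; [exact: mittag_leffler_entry|exact: cvg_cst].
  by apply/funext => N; rewrite /series/= mulr_suml.
apply/funext => k; rewrite mxE mulr_sumr; apply: eq_bigr => l _.
by rewrite scalemx_exp mxE; ring.
Qed.

End MittagLeffler.

(** * Essentially bounded functions and termwise integration of dominated series *)

Section EssBounded.
Context d (X : measurableType d) (R : realType) (nu : {measure set X -> \bar R}).
Variable (D : set X).
Hypothesis mD : measurable D.

Definition ess_bounded (f : X -> R) := measurable_fun D f /\
  exists2 C, 0 <= C & {ae nu, forall x, D x -> `|f x| <= C}.

Lemma ess_bounded_cst c : ess_bounded (fun=> c).
Proof. by split; [exact: measurable_cst|exists `|c| => //; apply: aeW]. Qed.

Lemma ess_boundedM f g : ess_bounded f -> ess_bounded g ->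
  ess_bounded (fun x => f x * g x).
Proof.
move=> [mf [a a0 fa]] [mg [b b0 gb]]; split; first exact: measurable_funM.
exists (a * b); first exact: mulr_ge0.
apply: filterS2 fa gb => x fx gx Dx; rewrite normrM ler_pM//; [exact: fx|exact: gx].
Qed.

Lemma ess_boundedD f g : ess_bounded f -> ess_bounded g ->
  ess_bounded (fun x => f x + g x).
Proof.
move=> [mf [a a0 fa]] [mg [b b0 gb]]; split; first exact: measurable_funD.
exists (a + b); first exact: addr_ge0.
apply: filterS2 fa gb => x fx gx Dx.
by rewrite (le_trans (ler_normD _ _))// lerD//; [exact: fx|exact: gx].
Qed.

Lemma ess_bounded_sum (I : Type) (r : seq I) (P : pred I) (f : I -> X -> R) :
  (forall i, P i -> ess_bounded (f i)) -> ess_bounded (fun x => \sum_(i <- r | P i) f i x).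
Proof.
move=> bf; elim: r => [|i r IH].
  by under eq_fun do rewrite big_nil; exact: ess_bounded_cst.
case Pi: (P i); last by under eq_fun do rewrite big_cons Pi.
by under eq_fun do rewrite big_cons Pi; apply: ess_boundedD => //; exact: bf.
Qed.

(** Dominated convergence for the constant sequence [f] turns an almost everywhere bound into
    integrability. *)
Lemma integrable_ae_le (f g : X -> R) : measurable_fun D f ->
  nu.-integrable D (EFin \o g) -> {ae nu, forall x, D x -> `|f x| <= g x} ->
  nu.-integrable D (EFin \o f).
Proof.
move=> mf ig fg.
have mf' : measurable_fun D (EFin \o f) by apply/measurable_EFinP.
have cf : {ae nu, forall x, D x -> (fun=> (EFin \o f) x) @ \oo --> (EFin \o f) x}.
  by apply: aeW => x _; exact: cvg_cst.
have lefg : {ae nu, forall x (n : nat), D x -> (`|(EFin \o f) x| <= (EFin \o g) x)%E}.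
  by apply: filterS fg => x fgx n Dx /=; rewrite lee_fin; exact: fgx.
by have [] := dominated_convergence mD (fun=> mf') mf' cf ig lefg.
Qed.

Lemma integrable_ess_boundedM (f g : X -> R) : ess_bounded f ->
  nu.-integrable D (EFin \o g) -> nu.-integrable D (EFin \o (fun x => f x * g x)).
Proof.
move=> [mf [a a0 fa]] ig.
have mg : measurable_fun D g by apply/measurable_EFinP; case/integrableP: ig.
apply: (@integrable_ae_le _ (fun x => a * `|g x|)).
- exact: measurable_funM.
- have /integrableZl := integrable_abse ig; move=> /(_ mD a).
  exact: eq_integrable.
- by apply: filterS fa => x fx Dx; rewrite normrM ler_wpM2r//; exact: fx.
Qed.

Lemma Rintegral_sum (I : Type) (r : seq I) (f : I -> X -> R) :
  (forall i, nu.-integrable D (EFin \o f i)) ->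
  \int[nu]_(x in D) (\sum_(i <- r) f i x) = \sum_(i <- r) \int[nu]_(x in D) f i x.
Proof.
move=> fi; elim: r => [|i r IH].
  by rewrite big_nil; under eq_Rintegral do rewrite big_nil; rewrite /Rintegral integral0.
rewrite big_cons -IH -RintegralD//; first by apply: eq_Rintegral => x _; rewrite big_cons.
have := integrable_sum mD r (fun i (_ : true) => fi i).
by apply: eq_integrable => // x _ /=; rewrite sumEFin.
Qed.

Lemma integrable_sumr (I : Type) (r : seq I) (f : I -> X -> R) :
  (forall i, nu.-integrable D (EFin \o f i)) ->
  nu.-integrable D (EFin \o (fun x => \sum_(i <- r) f i x)).
Proof.
move=> fi; have := integrable_sum mD r (fun i (_ : true) => fi i).
by apply: eq_integrable => // x _ /=; rewrite sumEFin.
Qed.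

Section Series.
Variables (f_ : nat -> X -> R) (F : X -> R) (K : R).
Hypothesis K0 : 0 <= K.
Hypothesis mf : forall k, measurable_fun D (f_ k).
Hypothesis fF : forall x, D x -> series (f_ ^~ x) @ \oo --> F x.

Let mseries n : measurable_fun D (fun x => series (f_ ^~ x) n).
Proof. by rewrite /series/=; apply: measurable_sum => i; exact: mf. Qed.

Let mF : measurable_fun D F.
Proof. by apply: (measurable_fun_cvg mseries). Qed.

Let geometric_half_le n : series (geometric K 2^-1) n <= 2 * K.
Proof.
have h2 : (2^-1 : R) != 1 by rewrite lt_eqF// invf_lt1// ltr1n.
rewrite geometric_seriesE//; have : 0 <= (2^-1 : R) ^+ n by rewrite exprn_ge0// invr_ge0.
set t := _ ^+ n => t0; rewrite ler_pdivrMr; last lra.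
rewrite (_ : 2 * K * (1 - 2^-1) = K); last by field.
rewrite mulrBr mulr1 gerBl mulr_ge0//.
Qed.

Lemma series_ess_bounded :
  {ae nu, forall x, D x -> forall k, `|f_ k x| <= geometric K 2^-1 k} -> ess_bounded F.
Proof.
move=> fK; split => //; exists (2 * K); first by rewrite mulr_ge0.
apply: filterS fK => x fx Dx.
have c : `|series (f_ ^~ x) n| @[n --> \oo] --> `|F x| by apply: cvg_norm; exact: fF.
rewrite -(cvg_lim _ c)//.
apply: limr_le; first by apply/cvg_ex; eexists; exact: c.
apply: nearW => n; apply: le_trans (ler_norm_sum _ _ _) _.
by apply: le_trans (geometric_half_le n); apply: ler_sum => k _; exact: fx.
Qed.

(** The partial sums are dominated by [2 K |g|], the sum of the geometric majorant, so dominated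
    convergence applies. *)
Lemma series_integral (g : X -> R) : nu.-integrable D (EFin \o g) ->
  {ae nu, forall x, D x -> forall k, `|f_ k x| <= geometric K 2^-1 k * `|g x|} ->
  nu.-integrable D (EFin \o F) /\
  series (fun k => \int[nu]_(x in D) f_ k x) @ \oo --> \int[nu]_(x in D) F x.
Proof.
move=> ig fK.
have ig' c : nu.-integrable D (EFin \o (fun x => c * `|g x|)).
  have /integrableZl := integrable_abse ig; move=> /(_ mD c).
  exact: eq_integrable.
have fi k : nu.-integrable D (EFin \o f_ k).
  apply: (integrable_ae_le _ (ig' (geometric K 2^-1 k))) => //.
  by apply: filterS fK => x fx Dx; exact: fx.
pose s n : X -> \bar R := EFin \o (fun x => series (f_ ^~ x) n).
have ms n : measurable_fun D (s n) by apply/measurable_EFinP.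
have mF' : measurable_fun D (EFin \o F) by apply/measurable_EFinP.
have cs : {ae nu, forall x, D x -> s ^~ x @ \oo --> (EFin \o F) x}.
  by apply: aeW => x Dx; apply: cvg_EFin; [exact: nearW|exact: fF].
have les : {ae nu, forall x n, D x -> (`|s n x| <= (2 * K * `|g x|)%R%:E)%E}.
  apply: filterS fK => x fx n Dx /=; rewrite lee_fin.
  apply: le_trans (ler_norm_sum _ _ _) _.
  apply: (@le_trans _ _ (series (geometric K 2^-1) n * `|g x|)).
    by rewrite /series/= mulr_suml; apply: ler_sum => k _; exact: fx.
  by rewrite ler_wpM2r.
have [iF _ c] := dominated_convergence mD ms mF' cs (ig' (2 * K)) les.
split => //.
rewrite (_ : series _ = fun n => fine (\int[nu]_(x in D) (series (f_ ^~ x) n)%:E)%E).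
  apply: fine_cvg; rewrite fineK//; exact: integrable_fin_num.
by apply/funext => n; rewrite /series/= -Rintegral_sum.
Qed.

End Series.
End EssBounded.

(* Expectation and time integral are exchanged coefficientwise in the power
   series [sum_k c_k h(s)^k q_k(sigma)], so no product measure is needed. *)
Section PowerSeries.
Context {R : realType} (alpha beta Y : R).
Hypotheses (alpha0 : 0 < alpha) (beta0 : 0 < beta) (Y0 : 0 <= Y).
Context d1 (X : measurableType d1) (nu : {measure set X -> \bar R}) (D : set X).
Hypothesis mD : measurable D.
Variable h : X -> R.
Hypotheses (mh : measurable_fun D h) (hY : forall x, D x -> 0 <= h x <= Y).
Local Notation c := (ml_coef alpha beta).

Let mcoef (q : R) k : measurable_fun D (fun x => c k * h x ^+ k * q).
Proof.
apply: measurable_funM => //; apply: measurable_funM => //.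
exact: measurable_funX.
Qed.

Lemma power_series_ess_bounded (q : nat -> R) (G : X -> R) : geo_bounded q ->
  (forall x, D x -> series (fun k => c k * h x ^+ k * q k) @ \oo --> G x) ->
  ess_bounded nu D G.
Proof.
move=> gq qG; have [K1 [C [K10 C0 qb]]] := gq.
have [K K0 Kb] := ml_term_majorant alpha0 beta0 K10 C0 Y0.
apply: (@series_ess_bounded _ _ _ _ _ (fun k x => c k * h x ^+ k * q k) _ K) => //.
by apply: aeW => x Dx k; apply: Kb; [exact: hY|exact: qb].
Qed.

Lemma ml_term_integrable (g : X -> R) k : nu.-integrable D (EFin \o g) ->
  nu.-integrable D (EFin \o (fun x => c k * h x ^+ k * g x)).
Proof.
apply: integrable_ess_boundedM => //; split.
  by have := mcoef 1 k; under eq_fun do rewrite mulr1.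
exists (`|c k| * Y ^+ k); first by rewrite mulr_ge0// exprn_ge0.
apply: aeW => x Dx; have /andP[h0 hx] := hY Dx.
by rewrite normrM ler_wpM2l// normrX ger0_norm// lerXn2r// nnegrE.
Qed.

(** In use [h s] is [(T - s)^alpha], [q] is independent of time, and [g] carries the integrable
    singularity [(T - s)^(alpha - 1)]; the series majorant times [|g|] dominates. *)
Lemma power_series_integral (q : nat -> R) (G g : X -> R) : geo_bounded q ->
  (forall x, D x -> series (fun k => c k * h x ^+ k * q k) @ \oo --> G x) ->
  nu.-integrable D (EFin \o g) ->
  nu.-integrable D (EFin \o (fun x => G x * g x)) /\
  series (fun k => q k * \int[nu]_(x in D) (c k * h x ^+ k * g x)) @ \oo -->
    \int[nu]_(x in D) (G x * g x).
Proof.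
move=> gq qG ig; have [K1 [C [K10 C0 qb]]] := gq.
have [K K0 Kb] := ml_term_majorant alpha0 beta0 K10 C0 Y0.
have mg : measurable_fun D g by apply/measurable_EFinP; case/integrableP: ig.
have mf k : measurable_fun D (fun x => c k * h x ^+ k * q k * g x).
  by apply: measurable_funM => //; exact: mcoef.
have cf x : D x -> series (fun k => c k * h x ^+ k * q k * g x) @ \oo --> G x * g x.
  move=> Dx; rewrite (_ : series _ = fun n => series (fun k => c k * h x ^+ k * q k) n * g x).
    by apply: cvgM; [exact: qG|exact: cvg_cst].
  by apply/funext => n; rewrite /series/= mulr_suml.
have bf : {ae nu, forall x, D x -> forall k,
    `|c k * h x ^+ k * q k * g x| <= geometric K 2^-1 k * `|g x|}.
  by apply: aeW => x Dx k; rewrite normrM ler_wpM2r//; apply: Kb; [exact: hY|exact: qb].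
have [iG cG] := series_integral mD K0 mf cf ig bf.
split => //; rewrite (_ : (fun k => _) = (fun k =>
   \int[nu]_(x in D) (c k * h x ^+ k * q k * g x))) //.
apply/funext => k; rewrite -RintegralZl//; last exact: ml_term_integrable.
by apply: eq_Rintegral => x _; ring.
Qed.

(** This bounds the time moments in the shape that [expectation_series] requires of its weights
    [w]. *)
Lemma ml_term_integral_le (g : X -> R) k : nu.-integrable D (EFin \o g) ->
  `|\int[nu]_(x in D) (c k * h x ^+ k * g x)| <=
    c k * Y ^+ k * \int[nu]_(x in D) `|g x|.
Proof.
move=> ig; have ik := ml_term_integrable k ig.
have ig' : nu.-integrable D (EFin \o (fun x => `|g x|)).
  by apply: eq_integrable (integrable_abse ig).
apply: le_trans (le_normr_Rintegral _ _) _ => //.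
rewrite -RintegralZl//; apply: le_Rintegral => //.
- by apply: eq_integrable (integrable_abse ik).
- by apply: eq_integrable (integrableZl mD _ ig').
- move=> x Dx; rewrite normrM ler_wpM2r// normrM.
  have c0 := ltW (ml_coef_gt0 k alpha0 beta0); have /andP[h0 hx] := hY Dx.
  by rewrite (ger0_norm c0) ler_wpM2l// normrX ger0_norm// lerXn2r// nnegrE.
Qed.

End PowerSeries.

(** * Expectation of series with random coefficients *)

Section ExpectationSeries.
Context {R : realType} (alpha beta Y K C I : R).
Hypotheses (alpha0 : 0 < alpha) (beta0 : 0 < beta) (Y0 : 0 <= Y).
Hypotheses (K0 : 0 <= K) (C0 : 0 <= C) (I0 : 0 <= I).
Context d (S : measurableType d) (mu : probability S R).
Local Notation c := (ml_coef alpha beta).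
Variable q : nat -> S -> R.
Hypothesis mq : forall k, measurable_fun [set: S] (q k).
Hypothesis qKC : {ae mu, forall s, forall k, `|q k s| <= K * C ^+ k}.

Let integrable1 : mu.-integrable [set: S] (EFin \o (fun=> 1 : R)).
Proof. exact: finite_measure_integrable_cst. Qed.

Lemma integrable_geo k : mu.-integrable [set: S] (EFin \o q k).
Proof.
have bq : ess_bounded mu [set: S] (q k).
  split=> //; exists (K * C ^+ k); first by rewrite mulr_ge0// exprn_ge0.
  by apply: filterS qKC => s + _; exact.
have := integrable_ess_boundedM measurableT bq integrable1.
by apply: eq_integrable => // s _; rewrite /= mulr1.
Qed.

(** Since the total mass is 1, the almost sure constants [K] and [C] carry over to the mean. *)
Lemma geo_bounded_expectation : geo_bounded (fun k => \int[mu]_s q k s).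
Proof.
exists K, C; split => // k; have ik := integrable_geo k.
rewrite -lee_fin EFin_normr_Rintegral//.
apply: le_trans (le_abse_integral _ _ _) _ => //; first by case/integrableP: ik.
apply: (@le_trans _ _ (\int[mu]_s (K * C ^+ k)%:E)%E).
  apply: ae_ge0_le_integral => //=.
  - by apply/measurable_EFinP; exact: measurableT_comp.
  - by move=> s _; rewrite lee_fin mulr_ge0// exprn_ge0.
  - by apply: filterS qKC => s qs _; rewrite lee_fin; exact: qs.
by rewrite integral_cst//= probability_setT mule1.
Qed.

(** Two kinds of weights are intended: [c k * x ^+ k] at a frozen time, with [I = 1], and time
    integrals of [c k * h ^+ k * g], with [I] the integral of [|g|]. *)
Lemma expectation_series (w : nat -> R) (J : S -> R) :
  (forall k, `|w k| <= c k * Y ^+ k * I) ->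
  (forall s, series (fun k => w k * q k s) @ \oo --> J s) ->
  ess_bounded mu setT J /\
  series (fun k => w k * \int[mu]_s q k s) @ \oo --> \int[mu]_s J s.
Proof.
move=> wb wJ.
have [D D0 Db] := ml_term_majorant alpha0 beta0 (mulr_ge0 I0 K0) C0 Y0.
have mf k : measurable_fun [set: S] (fun s => w k * q k s) by exact: measurable_funM.
have cf s : setT s -> series (fun k => w k * q k s) @ \oo --> J s by move=> _; exact: wJ.
have bf : {ae mu, forall s, setT s -> forall k, `|w k * q k s| <= geometric D 2^-1 k}.
  apply: filterS qKC => s qs _ k; rewrite normrM.
  apply: (@le_trans _ _ (c k * Y ^+ k * (I * (K * C ^+ k)))).
    by rewrite [leRHS]mulrA; apply: ler_pM.
  apply: le_trans (ler_norm _) (Db Y _ k _ _); first by rewrite Y0 lexx.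
  by rewrite mulrA ger0_norm// !mulr_ge0// exprn_ge0.
split; first exact: (series_ess_bounded D0 mf cf bf).
have bf1 : {ae mu, forall s, setT s -> forall k, `|w k * q k s| <= geometric D 2^-1 k * `|1 : R|}.
  by apply: filterS bf => s bs _ k; rewrite normr1 mulr1; exact: bs.
have [_] := series_integral measurableT D0 mf cf integrable1 bf1.
rewrite (_ : (fun k => \int[mu]_s (w k * q k s)) = fun k => w k * \int[mu]_s q k s)//.
by apply/funext => k; rewrite RintegralZl//; exact: integrable_geo.
Qed.

End ExpectationSeries.

(** * The right Riemann-Liouville integral of the adjoint state at time 0 *)

Section FractionalIntegral.
Context {R : realType} (alpha T : R).
Hypotheses (alpha01 : 0 < alpha < 1) (T_gt0 : 0 < T).
Local Notation leb := (@lebesgue_measure R).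

Let alpha0 : 0 < alpha. Proof. by case/andP: alpha01. Qed.

Lemma measurable_powR_sub (b : R) (D : set R) : measurable_fun D (fun s => (T - s) `^ b).
Proof.
apply: measurable_funTS.
apply: (@measurableT_comp _ _ _ _ _ _ (@powR R ^~ b)) => //.
exact: measurable_funB.
Qed.

Lemma time_to_go_bounds (s : R) : `]0, T[%classic s -> 0 <= (T - s) `^ alpha <= T `^ alpha.
Proof.
rewrite /= in_itv/= => /andP[s0 sT]; rewrite powR_ge0/=.
by apply: ge0_ler_powR; rewrite ?nnegrE ?(ltW alpha0)//; lra.
Qed.

Let mtime : measurable (`]0, T[%classic : set (measurableTypeR R)).
Proof. exact: measurable_itv. Qed.

Let mtime_to_go : measurable_fun (`]0, T[%classic : set (measurableTypeR R))
  (fun s : measurableTypeR R => (T - s) `^ alpha).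
Proof. exact: measurable_powR_sub. Qed.

Lemma integrable_beta (a b : R) : 0 < a -> 0 < b ->
  leb.-integrable `]0, T[ (EFin \o (fun s => s `^ (a - 1) * (T - s) `^ (b - 1))).
Proof.
move=> a0 b0; apply/integrableP; split.
  apply/measurable_EFinP/measurable_funM; last exact: measurable_powR_sub.
  by apply: measurable_funTS.
under eq_integral do rewrite /= ger0_norm ?mulr_ge0 ?powR_ge0//.
by rewrite /= beta_integral// ltry.
Qed.

Lemma integrable_weight : leb.-integrable `]0, T[ (EFin \o (fun s => (T - s) `^ (alpha - 1))).
Proof.
have := integrable_beta ltr01 alpha0.
by under [X in EFin \o X]eq_fun do rewrite subrr powRr0 mul1r.
Qed.

(** Integrating term by term, Euler's integral with exponents [1 - alpha] and [alpha k + alpha]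
    replaces [Gamma (alpha k + alpha)] by [Gamma (alpha k + 1)], which turns [E_(alpha,alpha)] into
    [E_alpha]; the spare factor [Gamma (1 - alpha)] cancels the normalization. *)
Lemma right_RL_adjoint_state (n : nat) (S : Type) (A : S -> 'M[R]_n) (y :
    'cV[R]_n) (sigma : S) :
  right_RL_integral alpha T (adjoint_state alpha T A y sigma) 0 =
  (mittag_leffler alpha 1 (T `^ alpha *: A sigma))^T *m y.
Proof.
rewrite -mittag_leffler_tr// linearZ/=.
set M := (A sigma)^T; apply/colP => i.
pose q k := (M ^+ k *m y) i 0.
pose g s := s `^ (1 - alpha - 1) * (T - s) `^ (alpha - 1).
have a1 : 0 < 1 - alpha by case/andP: alpha01; lra.
have gq : geo_bounded q by exact: geo_bounded_expmx_mul.
have ig : leb.-integrable `]0, T[ (EFin \o g) by exact: integrable_beta.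
pose G s := (mittag_leffler alpha alpha ((T - s) `^ alpha *: M) *m y) i 0.
have qG s : `]0, T[%classic s ->
    series (fun k => ml_coef alpha alpha k * ((T - s) `^ alpha) ^+ k * q k) @ \oo --> G s.
  by move=> _; exact: mittag_leffler_mul_entry.
have [_ cG] := power_series_integral alpha0 alpha0 (powR_ge0 T alpha)
  mtime mtime_to_go time_to_go_bounds gq qG ig.
have -> : right_RL_integral alpha T (adjoint_state alpha T A y sigma) 0 i 0 =
    (Gamma (1 - alpha))^-1 * \int[leb]_(s in `]0, T[) (G s * g s).
  rewrite /right_RL_integral !mxE; congr (_ * _); apply: eq_Rintegral => s _.
  rewrite /G /g /adjoint_state -/M subr0 mxE [X in _ * X]mxE addrAC subrr add0r; ring.
have G0 : Gamma (1 - alpha) != 0 by rewrite gt_eqF// Gamma_gt0.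
apply: (mulfI G0); rewrite mulVKf//.
(* The powers of [T - s] merge into one Beta integrand; its exponents add up so that exactly
   [T^(alpha k)] is left. *)
have ck k : \int[leb]_(s in `]0, T[) (ml_coef alpha alpha k * ((T - s) `^ alpha) ^+ k * g s) =
    Gamma (1 - alpha) * (ml_coef alpha 1 k * (T `^ alpha) ^+ k).
  have b0 := ml_arg_gt0 k alpha0 alpha0.
  have ib := integrable_beta a1 b0.
  transitivity (\int[leb]_(s in `]0, T[) (ml_coef alpha alpha k *
      (s `^ (1 - alpha - 1) * (T - s) `^ (alpha * k%:R + alpha - 1)))).
    apply: eq_Rintegral => s; rewrite inE/= in_itv/= => /andP[s0 sT].
    have Ts : T - s != 0 by rewrite subr_eq0 gt_eqF.
    have -> : (T - s) `^ (alpha * k%:R + alpha - 1) =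
        (T - s) `^ alpha ^+ k * (T - s) `^ (alpha - 1).
      by rewrite -addrA [LHS]powRD ?Ts ?implybT// powRrM powR_mulrn ?powR_ge0.
    rewrite /g; ring.
  rewrite RintegralZl// /Rintegral beta_integral//=.
  have -> : 1 - alpha + (alpha * k%:R + alpha) = alpha * k%:R + 1 by ring.
  rewrite addrK powRrM powR_mulrn ?powR_ge0// /ml_coef.
  have h1 : Gamma (alpha * k%:R + alpha) != 0 by rewrite gt_eqF// Gamma_gt0.
  have h2 : Gamma (alpha * k%:R + 1) != 0 by rewrite gt_eqF// Gamma_gt0// ml_arg_gt0.
  by field; rewrite h1 h2.
have cR : Gamma (1 - alpha) * series (fun k => ml_coef alpha 1 k * (T `^ alpha) ^+ k * q k) N
    @[N --> \oo] --> Gamma (1 - alpha) * (mittag_leffler alpha 1 (T `^ alpha *: M) *m y) i 0.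
  by apply: cvgM; [exact: cvg_cst|exact: mittag_leffler_mul_entry].
rewrite -(cvg_lim _ cG)// -(cvg_lim _ cR)//; congr (limn _); apply/funext => N.
rewrite /series/= mulr_sumr; apply: eq_bigr => k _; rewrite ck; ring.
Qed.

End FractionalIntegral.

(** * Euclidean scalar product and invertibility from a trivial kernel *)

Section Dotc.
Context {R : realType} {k : nat}.
Implicit Types x y z : 'cV[R]_k.

Lemma dotcC x y : dotc x y = dotc y x.
Proof. by apply: eq_bigr => i _; rewrite mulrC. Qed.

Lemma dotcDl x y z : dotc (x + y) z = dotc x z + dotc y z.
Proof. by rewrite -big_split; apply: eq_bigr => i _; rewrite mxE mulrDl. Qed.

Lemma dotcZl a x y : dotc (a *: x) y = a * dotc x y.
Proof. by rewrite /dotc mulr_sumr; apply: eq_bigr => i _; rewrite mxE mulrA. Qed.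

Lemma dotcBl x y z : dotc (x - y) z = dotc x z - dotc y z.
Proof. by rewrite dotcDl -scaleN1r dotcZl mulN1r. Qed.

Lemma dotcBr x y z : dotc z (x - y) = dotc z x - dotc z y.
Proof. by rewrite !(dotcC z) dotcBl. Qed.

Lemma dotc_ge0 x : 0 <= dotc x x.
Proof. by apply: sumr_ge0 => i _; rewrite -expr2 sqr_ge0. Qed.

Lemma dotc_eq0 x : dotc x x = 0 -> x = 0.
Proof.
move=> /eqP; rewrite psumr_eq0 => [/allP x0|i _]; last by rewrite -expr2 sqr_ge0.
apply/colP => i; rewrite mxE; apply/eqP.
by have := x0 i (mem_index_enum _); rewrite mulf_eq0 orbb.
Qed.

End Dotc.

Lemma dotc_mulmxl (R : realType) (k l : nat) (M : 'M[R]_(k, l)) x y :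
  dotc (M *m x) y = dotc x (M^T *m y).
Proof.
rewrite /dotc; under eq_bigr do rewrite mxE mulr_suml.
rewrite exchange_big; apply: eq_bigr => j _; rewrite mxE mulr_sumr.
by apply: eq_bigr => i _; rewrite mxE; ring.
Qed.

Lemma unitmx_ker0 (F : fieldType) (k : nat) (M : 'M[F]_k) :
  (forall y : 'cV[F]_k, M *m y = 0 -> y = 0) -> M \in unitmx.
Proof.
move=> M0; rewrite -unitmx_tr -row_free_unit; apply: inj_row_free => v vM.
apply: trmx_inj; rewrite trmx0; apply: M0.
by rewrite -[M]trmxK -trmx_mul vM trmx0.
Qed.

(** * Essential bounds and measurability for matrix-valued functions *)

Section EssentialBounds.
Context d (S : measurableType d) (R : realType) (nu : {measure set S -> \bar R}).

Lemma LfunyP (f : S -> R) : f \in Lfun nu +oo%E <-> ess_bounded nu setT f.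
Proof.
split=> [/andP[]|[mf [C C0 fC]]].
  rewrite !inE/= => mf; rewrite /finite_norm unlock => fy; split => //.
  move: fy; case: ifPn => [nu0 fy|].
    have [|M fM] := @ess_supr_bounded _ _ _ nu (Num.norm \o f).
      by move: fy; congr (ess_sup _ _ < _)%E.
    exists `|M| => //; apply: filterS fM => x fxM _; exact: le_trans (ler_norm M).
  (* When the total mass is zero, the whole space is negligible and the bound 0 holds almost
     everywhere. *)
  rewrite -leNgt => nu0 _; exists 0 => //; exists setT; split => //.
  by apply/eqP; rewrite eq_le nu0/=.
apply/andP; split; rewrite !inE//= /finite_norm unlock; case: ifPn => // nu0.
apply: (@le_lt_trans _ _ C%:E); last exact: ltry.
by apply/ess_supP; apply: filterS fC => x fx /=; rewrite lee_fin; exact: fx.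
Qed.

(** The sum of the finitely many entry bounds works for all entries, outside a single null set. *)
Lemma mx_ess_bound (p q : nat) (M : S -> 'M[R]_(p, q)) :
  (forall i j, ess_bounded nu setT (fun s => M s i j)) ->
  exists2 a, 0 <= a & {ae nu, forall s, forall i j, `|M s i j| <= a}.
Proof.
move=> bM; have C i j : {c : R | 0 <= c /\ {ae nu, forall s, `|M s i j| <= c}}.
  apply: cid; have [_ [c c0 Mc]] := bM i j; exists c; split => //.
  by apply: filterS Mc => s; exact.
exists (\sum_i \sum_j sval (C i j)).
  by apply: sumr_ge0 => i _; apply: sumr_ge0 => j _; case: (svalP (C i j)).
apply: filter_forall => i; apply: filter_forall => j.
have [_] := svalP (C i j); apply: filterS => s; move/le_trans; apply.
have C0 i' j' : 0 <= sval (C i' j') by case: (svalP (C i' j')).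
rewrite (bigD1 i)//= (bigD1 j)//= -addrA lerDl addr_ge0 ?sumr_ge0// => k _.
exact: sumr_ge0.
Qed.

Lemma measurable_mulmx (p q r : nat) (M : S -> 'M[R]_(p, q)) (N : S -> 'M[R]_(q, r)) :
  (forall i j, measurable_fun setT (fun s => M s i j)) ->
  (forall i j, measurable_fun setT (fun s => N s i j)) ->
  forall i j, measurable_fun setT (fun s => (M s *m N s) i j).
Proof.
move=> mM mN i j; under eq_fun do rewrite mxE.
by apply: measurable_sum => l; exact: measurable_funM.
Qed.

Lemma measurable_expmx (p : nat) (M : S -> 'M[R]_p) k :
  (forall i j, measurable_fun setT (fun s => M s i j)) ->
  forall i j, measurable_fun setT (fun s => (M s ^+ k) i j).
Proof.
move=> mM; elim: k => [|k IH] i j; first by under eq_fun do rewrite expr0;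
    exact: measurable_cst.
by under eq_fun do rewrite exprS; exact: measurable_mulmx.
Qed.

End EssentialBounds.

(** * Admissible controls and the weighted scalar product *)

Section Controls.
Context {R : realType} (alpha T : R) {m : nat}.
Hypotheses (alpha01 : 0 < alpha < 1) (T_gt0 : 0 < T).
Local Notation leb := (@lebesgue_measure R).
Implicit Types u v : R -> 'cV[R]_m.

Let mtime : measurable (`]0, T[%classic : set (measurableTypeR R)).
Proof. exact: measurable_itv. Qed.

Lemma admissible_controlP u : admissible_control T u <->
  forall i, ess_bounded leb (`]0, T[%classic : set (measurableTypeR R)) (fun s => u s i 0).
Proof.
have E i (j : 'I_1) : (fun s => (u \_ `]0, T[) s i j) = (fun s => u s i 0) \_ `]0, T[.
  by apply/funext => s; rewrite !patchE ord1; case: ifPn => // _; rewrite mxE.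
split=> [uT i|uT i j].
  have := uT i 0; rewrite E => /LfunyP[mu [C C0 uC]]; split.
    exact/(measurable_restrictT _ mtime).
  exists C => //; apply: filterS uC => s + sT; rewrite patchE mem_set//; exact.
rewrite E; apply/LfunyP; have [mu [C C0 uC]] := uT i; split.
  exact/(measurable_restrictT _ mtime).
exists C => //; apply: filterS uC => s us _; rewrite patchE.
by case: ifPn => [/set_mem sT|_]; [exact: us|rewrite normr0].
Qed.

Lemma weighted_integrable (f : R -> R) :
  ess_bounded leb (`]0, T[%classic : set (measurableTypeR R)) f ->
  leb.-integrable `]0, T[ (EFin \o (fun s => (T - s) `^ (alpha - 1) * f s)).
Proof.
move=> bf; have := integrable_ess_boundedM mtime bf (integrable_weight alpha01 T_gt0).
by apply: eq_integrable => // s _ /=; rewrite mulrC.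
Qed.

Lemma ess_bounded_dotc u v : admissible_control T u -> admissible_control T v ->
  ess_bounded leb (`]0, T[%classic : set (measurableTypeR R)) (fun s => dotc (u s) (v s)).
Proof.
move=> /admissible_controlP uT /admissible_controlP vT.
by apply: ess_bounded_sum => // i _; exact: ess_boundedM.
Qed.

Lemma admissibleB u v : admissible_control T u -> admissible_control T v ->
  admissible_control T (u \- v).
Proof.
move=> /admissible_controlP uT /admissible_controlP vT; apply/admissible_controlP => i.
rewrite (_ : (fun s => _) = fun s => u s i 0 + -1 * v s i 0).
  by apply: ess_boundedD => //; apply: ess_boundedM => //; exact: ess_bounded_cst.
by apply/funext => s; rewrite !mxE mulN1r.
Qed.

Lemma wL2_dotC u v : wL2_dot alpha T u v = wL2_dot alpha T v u.
Proof. by apply: eq_Rintegral => s _; rewrite dotcC. Qed.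

Lemma wL2_dot_ge0 u : 0 <= wL2_dot alpha T u u.
Proof. by apply: Rintegral_ge0 => s _; rewrite mulr_ge0 ?powR_ge0 ?dotc_ge0. Qed.

Lemma wL2_dotBl u v z : admissible_control T u -> admissible_control T v ->
  admissible_control T z ->
  wL2_dot alpha T (u \- v) z = wL2_dot alpha T u z - wL2_dot alpha T v z.
Proof.
move=> uT vT zT; rewrite /wL2_dot -RintegralB//.
- by apply: eq_Rintegral => s _; rewrite dotcBl mulrBr.
- by apply: weighted_integrable; exact: ess_bounded_dotc.
- by apply: weighted_integrable; exact: ess_bounded_dotc.
Qed.

(** A nonnegative integrand of zero integral vanishes almost everywhere, and the weight is nonzero
    because [s < T]. *)
Lemma wL2_dot_eq0 u : admissible_control T u -> wL2_dot alpha T u u = 0 ->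
  u = cst 0 %[ae leb in `]0, T[%classic].
Proof.
move=> uT u0.
have iu := weighted_integrable (ess_bounded_dotc uT uT).
pose f (s : R) := (T - s) `^ (alpha - 1) * dotc (u s) (u s).
have mf : measurable_fun (`]0, T[%classic : set (measurableTypeR R)) (EFin \o f).
  by case/integrableP: iu.
have [+ _] := ae_eq_integral_abs leb mtime mf.
have -> : (\int[leb]_(s in `]0%R, T[) `|(EFin \o f) s| = 0)%E.
  under eq_integral do rewrite /= ger0_norm ?mulr_ge0 ?powR_ge0 ?dotc_ge0//.
  transitivity ((wL2_dot alpha T u u)%:E); last by rewrite u0.
  by rewrite fineK//; exact: integrable_fin_num.
move=> /(_ erefl); apply: filterS => s us sT; apply: dotc_eq0.
have /eqP := us sT; rewrite /= eqe mulf_eq0 => /orP[|/eqP//].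
move: sT; rewrite /= in_itv/= => /andP[s0 sT].
by rewrite powR_eq0 subr_eq0 gt_eqF.
Qed.

Lemma wL2_dot_ae0 u v : admissible_control T u -> admissible_control T v ->
  u = cst 0 %[ae leb in `]0, T[%classic] -> wL2_dot alpha T u v = 0.
Proof.
move=> uT vT u0; have iu := weighted_integrable (ess_bounded_dotc uT vT).
rewrite /wL2_dot /Rintegral (ae_eq_integral (cst 0%E))//.
- by rewrite integral0.
- by case/integrableP: iu.
  apply: (filterS (F := almost_everywhere leb) _ u0) => s us sT;
      rewrite /= us// /dotc big1 ?mulr0// => i _.
  by rewrite mxE mul0r.
Qed.

End Controls.

(** * Averaged Mittag-Leffler kernel and exchange of expectation with time integration *)

Section AveragedSystem.
Context {R : realType} (alpha T : R) {n m : nat}.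
Context d (S : measurableType d) (mu : probability S R).
Variables (A : S -> 'M[R]_n) (B : S -> 'M[R]_(n, m)).
Hypotheses (alpha01 : 0 < alpha < 1) (T_gt0 : 0 < T).
Hypotheses (A_Linfty : mxLfun mu +oo%E A) (B_Linfty : mxLfun mu +oo%E B).
Local Notation leb := (@lebesgue_measure R).
Local Notation weight s := ((T - s) `^ (alpha - 1)).
Local Notation to_go s := ((T - s) `^ alpha).

Let alpha0 : 0 < alpha. Proof. by case/andP: alpha01. Qed.

Let mtime : measurable (`]0, T[%classic : set (measurableTypeR R)).
Proof. exact: measurable_itv. Qed.

Let mto_go : measurable_fun (`]0, T[%classic : set (measurableTypeR R))
  (fun s : measurableTypeR R => to_go s).
Proof. exact: measurable_powR_sub. Qed.

Lemma mxexpectationE (p q : nat) (f : S -> 'M[R]_(p, q)) i j :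
  mxexpectation mu f i j = \int[mu]_s f s i j.
Proof. by rewrite mxE unlock. Qed.

Lemma integrable_ess_bounded (f : S -> R) : ess_bounded mu setT f ->
  mu.-integrable setT (EFin \o f).
Proof.
move=> bf; have i1 : mu.-integrable [set: S] (EFin \o (fun=> 1 : R)).
  exact: finite_measure_integrable_cst.
have := integrable_ess_boundedM measurableT bf i1.
by apply: eq_integrable => // s _; rewrite /= mulr1.
Qed.

(** One null set and one pair of constants serve all powers [k], because only [A] and [Q] themselves
    are bounded almost surely. *)
Lemma expmx_mul_ess_bound (p : nat) (Q : S -> 'M[R]_(n, p)) :
  (forall i j, ess_bounded mu setT (fun s => Q s i j)) ->
  exists K C, [/\ 0 <= K, 0 <= C & {ae mu, forall s, forall k i j,
    `|(A s ^+ k *m Q s) i j| <= K * C ^+ k}].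
Proof.
move=> bQ; have [b b0 Qb] := mx_ess_bound bQ.
have [a a0 Aa] := mx_ess_bound (fun i j => (LfunyP mu _).1 (A_Linfty i j)).
exists (n%:R * b), (n%:R * a); split; rewrite ?mulr_ge0//.
apply: filterS2 Aa Qb => s As Qs k i j.
rewrite mulrAC; apply: mulmx_bound => //; first by rewrite exprn_ge0// mulr_ge0.
exact: expmx_bound.
Qed.

Lemma measurable_expmx_mul (p : nat) (Q : S -> 'M[R]_(n, p)) k i j :
  (forall i j, ess_bounded mu setT (fun s => Q s i j)) ->
  measurable_fun setT (fun s => (A s ^+ k *m Q s) i j).
Proof.
move=> bQ; apply: measurable_mulmx => [i' j'|i' j']; last by case: (bQ i' j').
by apply: measurable_expmx => i2 j2; case/LfunyP: (A_Linfty i2 j2).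
Qed.

Lemma mittag_leffler_expectation beta (p : nat) (Q : S -> 'M[R]_(n, p)) x i j :
  0 < beta -> 0 <= x -> (forall i j, ess_bounded mu setT (fun s => Q s i j)) ->
  ess_bounded mu setT (fun s => (mittag_leffler alpha beta (x *: A s) *m Q s) i j) /\
  series (fun k => ml_coef alpha beta k * x ^+ k * \int[mu]_s (A s ^+ k *m Q s) i j)
    @ \oo --> \int[mu]_s (mittag_leffler alpha beta (x *: A s) *m Q s) i j.
Proof.
move=> beta0 x0 bQ; have [K [C [K0 C0 KC]]] := expmx_mul_ess_bound bQ.
apply: (@expectation_series _ alpha beta x K C 1 _ _ _ _ _ _ _ _ _
  (fun k s => (A s ^+ k *m Q s) i j)) => //.
- by move=> k; exact: measurable_expmx_mul.
- by apply: filterS KC => s Ks k; exact: Ks.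
- move=> k; rewrite mulr1 ger0_norm// mulr_ge0 ?exprn_ge0//.
  by rewrite ltW// ml_coef_gt0.
- by move=> s; exact: mittag_leffler_mul_entry.
Qed.

Let bB i j : ess_bounded mu setT (fun s => B s i j).
Proof. exact/LfunyP. Qed.

(** This is [Phi] as a function of [x = (T - s)^alpha], in which it is an ordinary power series. *)
Definition averaged_kernel (x : R) : 'M[R]_(n, m) :=
  mxexpectation mu (fun s => mittag_leffler alpha alpha (x *: A s) *m B s).

Let coef i j k := \int[mu]_s (A s ^+ k *m B s) i j.

Let geo_coef i j : geo_bounded (coef i j).
Proof.
have [K [C [K0 C0 KC]]] := expmx_mul_ess_bound bB.
apply: (@geo_bounded_expectation _ K C _ _ _ _ mu (fun k s => (A s ^+ k *m B s) i j)) => //.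
- by move=> k; exact: measurable_expmx_mul.
- by apply: filterS KC => s Ks k; exact: Ks.
Qed.

Let series_kernel i j s : `]0, T[%classic s ->
  series (fun k => ml_coef alpha alpha k * to_go s ^+ k * coef i j k) @ \oo -->
  averaged_kernel (to_go s) i j.
Proof.
move=> _; rewrite mxexpectationE.
by have [] := mittag_leffler_expectation i j alpha0 (powR_ge0 (T - s) alpha) bB.
Qed.

Lemma averaged_kernel_ess_bounded i j :
  ess_bounded leb (`]0, T[%classic : set (measurableTypeR R))
    (fun s => averaged_kernel (to_go s) i j).
Proof.
exact: (power_series_ess_bounded alpha0 alpha0 (powR_ge0 T alpha) _ mto_go
  (time_to_go_bounds alpha01) (geo_coef i j) (@series_kernel i j)).
Qed.

Section Exchange.
Variables (g : R -> R) (i : 'I_n) (j : 'I_m).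
Hypothesis ig : leb.-integrable `]0, T[ (EFin \o g).

Lemma averaged_kernel_integrable :
  leb.-integrable `]0, T[ (EFin \o (fun s => averaged_kernel (to_go s) i j * g s)).
Proof.
by have [] := power_series_integral alpha0 alpha0 (powR_ge0 T alpha) mtime mto_go
  (time_to_go_bounds alpha01) (geo_coef i j) (@series_kernel i j) ig.
Qed.

Let kernel_series sigma := power_series_integral alpha0 alpha0 (powR_ge0 T alpha)
  mtime mto_go (time_to_go_bounds alpha01)
  (geo_bounded_expmx_mul (A sigma) (B sigma) i j)
  (fun s _ => @mittag_leffler_mul_entry _ _ _ _ _ (to_go s) (A sigma) (B sigma) i j alpha0 alpha0) ig.

Lemma kernel_integrable sigma : leb.-integrable `]0, T[ (EFin \o (fun s =>
  (mittag_leffler alpha alpha (to_go s *: A sigma) *m B sigma) i j * g s)).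
Proof. exact: (kernel_series sigma).1. Qed.

(** Both iterated integrals are the sum of the same series, whose terms are time moments [w k] times
    expectations of [q k]. *)
Lemma averaged_kernel_integral :
  ess_bounded mu setT (fun sigma => \int[leb]_(s in `]0, T[)
    ((mittag_leffler alpha alpha (to_go s *: A sigma) *m B sigma) i j * g s)) /\
  \int[mu]_sigma (\int[leb]_(s in `]0, T[)
    ((mittag_leffler alpha alpha (to_go s *: A sigma) *m B sigma) i j * g s)) =
  \int[leb]_(s in `]0, T[) (averaged_kernel (to_go s) i j * g s).
Proof.
have [K [C [K0 C0 KC]]] := expmx_mul_ess_bound bB.
pose w k := \int[leb]_(s in `]0, T[) (ml_coef alpha alpha k * to_go s ^+ k * g s).
pose q k sigma := (A sigma ^+ k *m B sigma) i j.
pose J sigma := \int[leb]_(s in `]0, T[)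
  ((mittag_leffler alpha alpha (to_go s *: A sigma) *m B sigma) i j * g s).
have I0 : 0 <= \int[leb]_(s in `]0, T[) `|g s| by exact: Rintegral_ge0.
have mq k : measurable_fun setT (q k) by exact: measurable_expmx_mul.
have qb : {ae mu, forall sigma, forall k, `|q k sigma| <= K * C ^+ k}.
  by apply: filterS KC => s Ks k; exact: Ks.
have wb k : `|w k| <= ml_coef alpha alpha k * (T `^ alpha) ^+ k * \int[leb]_(s in `]0, T[) `|g s|.
  exact: (ml_term_integral_le alpha0 alpha0 (powR_ge0 T alpha) mtime mto_go
    (time_to_go_bounds alpha01) k ig).
have wJ sigma : series (fun k => w k * q k sigma) @ \oo --> J sigma.
  by have [_] := kernel_series sigma; under eq_fun do rewrite mulrC.
have [bJ cJ] := expectation_series alpha0 alpha0 (powR_ge0 T alpha) K0 C0 I0 mq qb wb wJ.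
split=> //; rewrite -[LHS](cvg_lim _ cJ)//.
have [_ cP] := power_series_integral alpha0 alpha0 (powR_ge0 T alpha) mtime mto_go
  (time_to_go_bounds alpha01) (geo_coef i j) (@series_kernel i j) ig.
rewrite -(cvg_lim _ cP)//; congr (limn (series _)); apply/funext => k.
by rewrite mulrC.
Qed.

End Exchange.
End AveragedSystem.

(** * Control operator, its adjoint, the Gramian, and the functional as a quadratic form *)

Section MinimumNormControl.
Context {R : realType} (alpha T : R) {n m : nat}.
Context d (S : measurableType d) (mu : probability S R).
Variables (A : S -> 'M[R]_n) (B : S -> 'M[R]_(n, m)).
Hypotheses (alpha01 : 0 < alpha < 1) (T_gt0 : 0 < T).
Hypotheses (A_Linfty : mxLfun mu +oo%E A) (B_Linfty : mxLfun mu +oo%E B).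
Local Notation leb := (@lebesgue_measure R).
Local Notation weight s := ((T - s) `^ (alpha - 1)).
Local Notation to_go s := ((T - s) `^ alpha).
Local Notation kernel s := (averaged_kernel alpha mu A B (to_go s)).
Local Notation ua := (ua alpha T mu A B).

Let alpha0 : 0 < alpha. Proof. by case/andP: alpha01. Qed.

Let mtime : measurable (`]0, T[%classic : set (measurableTypeR R)).
Proof. exact: measurable_itv. Qed.

(** The operator [L], with the sum outside the integral because the exchange above treats one scalar
    entry at a time. *)
Definition control_map (u : R -> 'cV[R]_m) : 'cV[R]_n :=
  \col_i \sum_l \int[leb]_(s in `]0, T[) (kernel s i l * (weight s * u s l 0)).

Definition free_state (x0 : S -> 'cV[R]_n) : 'cV[R]_n :=
  mxexpectation mu (fun sigma => mittag_leffler alpha 1 (T `^ alpha *: A sigma) *m x0 sigma).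

Let ig (u : R -> 'cV[R]_m) l : admissible_control T u ->
  leb.-integrable `]0, T[ (EFin \o (fun s => weight s * u s l 0)).
Proof. by move=> /admissible_controlP uT; exact: weighted_integrable. Qed.

(** Each entry is a sum of products of an essentially bounded Mittag-Leffler entry and an integrable
    datum. *)
Let mul_x0_integrable (x0 : S -> 'cV[R]_n) i : mxLfun mu 1%E x0 -> mu.-integrable setT
  (EFin \o (fun sigma => (mittag_leffler alpha 1 (T `^ alpha *: A sigma) *m x0 sigma) i 0)).
Proof.
move=> ix0; under [X in EFin \o X]eq_fun do rewrite mxE.
apply: integrable_sumr => // j; apply: integrable_ess_boundedM => //; last first.
  exact/Lfun1_integrable.
have b1 (i1 j1 : 'I_n) : ess_bounded mu setT (fun=> (1%:M : 'M[R]_n) i1 j1).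
  exact: ess_bounded_cst.
have [+ _] := mittag_leffler_expectation alpha01 A_Linfty i j ltr01 (powR_ge0 T alpha) b1.
by under eq_fun do rewrite mulmx1.
Qed.

Lemma expectation_caputo_solution x0 u : mxLfun mu 1%E x0 -> admissible_control T u ->
  mxexpectation mu (caputo_solution alpha A B x0 u T) = free_state x0 + control_map u.
Proof.
move=> ix0 uT; apply/colP => i; rewrite mxexpectationE !mxE -[X in X + _]/(fine _).
have E sigma : caputo_solution alpha A B x0 u T sigma i 0 =
   (mittag_leffler alpha 1 (T `^ alpha *: A sigma) *m x0 sigma) i 0 +
   \sum_l \int[leb]_(s in `]0, T[)
    ((mittag_leffler alpha alpha (to_go s *: A sigma) *m B sigma) i l * (weight s * u s l 0)).
  rewrite mxE; congr (_ + _); rewrite mxE -Rintegral_sum//; last first.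
    by move=> l; apply: kernel_integrable => //; exact: ig.
  by apply: eq_Rintegral => s _; rewrite mxE mxE mulr_sumr; apply: eq_bigr => l _; ring.
rewrite unlock; under eq_Rintegral do rewrite E.
have iJ l : mu.-integrable setT (EFin \o (fun sigma => \int[leb]_(s in `]0, T[)
    ((mittag_leffler alpha alpha (to_go s *: A sigma) *m B sigma) i l * (weight s * u s l 0)))).
  apply: integrable_ess_bounded.
  by have [] := averaged_kernel_integral alpha01 A_Linfty B_Linfty i l (ig l uT).
rewrite RintegralD//; last 2 first.
- exact: mul_x0_integrable.
- exact: integrable_sumr.
congr (_ + _); rewrite Rintegral_sum//; apply: eq_bigr => l _.
by have [] := averaged_kernel_integral alpha01 A_Linfty B_Linfty i l (ig l uT).
Qed.

Lemma uaE y s : ua y s = (kernel s)^T *m y.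
Proof.
congr (_ *m _); apply/matrixP => i j; rewrite [RHS]mxE !mxexpectationE.
apply: eq_Rintegral => sigma _; rewrite -linearZ/= mittag_leffler_tr//.
by rewrite -trmx_mul mxE.
Qed.

Lemma ua_admissible y : admissible_control T (ua y).
Proof.
apply/admissible_controlP => i.
rewrite (_ : (fun s => ua y s i 0) = fun s => \sum_j kernel s j i * y j 0).
  apply: ess_bounded_sum => // j _; apply: ess_boundedM => //; last exact: ess_bounded_cst.
  exact: averaged_kernel_ess_bounded.
by apply/funext => s; rewrite uaE mxE; apply: eq_bigr => j _; rewrite mxE.
Qed.

(** Adjointness: pointwise, the product of [Phi^T y] with [u] is that of [y] with [Phi u], and the
    constant [y] leaves the integral. *)
Lemma wL2_dot_ua y u : admissible_control T u ->
  wL2_dot alpha T (ua y) u = dotc y (control_map u).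
Proof.
move=> uT; have ik j l : leb.-integrable `]0, T[ (EFin \o (fun s => kernel s j l * (weight s * u s l 0))).
  by apply: averaged_kernel_integrable => //; exact: ig.
have isum j : leb.-integrable `]0, T[ (EFin \o (fun s => \sum_l kernel s j l * (weight s * u s l 0))).
  exact: integrable_sumr.
transitivity (\int[leb]_(s in `]0, T[) (\sum_j y j 0 * \sum_l kernel s j l * (weight s * u s l 0))).
  apply: eq_Rintegral => s _; rewrite uaE dotc_mulmxl trmxK /dotc mulr_sumr.
  apply: eq_bigr => j _; rewrite mxE mulrCA; congr (_ * _); rewrite mulr_sumr.
  by apply: eq_bigr => l _; ring.
rewrite Rintegral_sum//; last first.
  by move=> j; have := integrableZl mtime (y j 0) (isum j).
apply: eq_bigr => j _; rewrite RintegralZl// mxE; congr (_ * _).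
by rewrite Rintegral_sum.
Qed.

(** The integral of [(T - s)^(alpha - 1) Phi Phi^T], written entrywise. *)
Definition gramian : 'M[R]_n :=
  \matrix_(i, j) \sum_l \int[leb]_(s in `]0, T[) (kernel s i l * (weight s * kernel s j l)).

Lemma control_map_ua y : control_map (ua y) = gramian *m y.
Proof.
have ik i j l : leb.-integrable `]0, T[ (EFin \o (fun s => kernel s i l * (weight s * kernel s j l))).
  apply: averaged_kernel_integrable => //; apply: weighted_integrable => //.
  exact: averaged_kernel_ess_bounded.
apply/colP => i; rewrite !mxE.
under [RHS]eq_bigr do rewrite mxE mulr_suml.
rewrite exchange_big; apply: eq_bigr => l _.
transitivity (\int[leb]_(s in `]0, T[) (\sum_j y j 0 * (kernel s i l * (weight s * kernel s j l)))).
  apply: eq_Rintegral => s _; rewrite uaE [(_ *m y) l 0]mxE !mulr_sumr; apply: eq_bigr => j _.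
  by rewrite [_^T _ _]mxE; ring.
rewrite Rintegral_sum//; last first.
  by move=> j; have := integrableZl mtime (y j 0) (ik i j l).
by apply: eq_bigr => j _; rewrite RintegralZl// mulrC.
Qed.

(** The quadratic term is half the weighted square norm of [ua y], and the fractional-integral term
    is the product of [y] with the averaged free evolution. *)
Lemma JaE x0 x1 y : mxLfun mu 1%E x0 ->
  Ja alpha T mu A B x0 x1 y = 2^-1 * dotc y (gramian *m y) - dotc (x1 - free_state x0) y.
Proof.
move=> ix0; rewrite -control_map_ua -wL2_dot_ua; last exact: ua_admissible.
rewrite /Ja dotcBl opprD opprK addrA; congr (_ * _ - _ + _).
  apply: eq_Rintegral => s; rewrite inE/= in_itv/= => /andP[s0 sT].
  have -> : mxexpectation mu (fun sigma => (B sigma)^T *m adjoint_state alpha T A y sigma s) =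
      weight s *: ua y s.
    apply/colP => i; rewrite mxexpectationE uaE [RHS]mxE [(_ *m y) i 0]mxE.
    pose f j sigma := (mittag_leffler alpha alpha (to_go s *: A sigma) *m B sigma) j i.
    have fi j : mu.-integrable setT (EFin \o f j).
      apply: integrable_ess_bounded.
      have bB i1 j1 : ess_bounded mu setT (fun s => B s i1 j1) by exact/LfunyP.
      by have [] := mittag_leffler_expectation alpha01 A_Linfty j i alpha0 (powR_ge0 (T - s) alpha) bB.
    transitivity (\int[mu]_sigma (\sum_j (weight s * y j 0) * f j sigma)).
      apply: eq_Rintegral => sigma _.
      have -> : adjoint_state alpha T A y sigma s =
          weight s *: ((mittag_leffler alpha alpha (to_go s *: A sigma))^T *m y).
        by rewrite -mittag_leffler_tr// linearZ.
      rewrite -scalemxAr mulmxA -trmx_mul mxE [(_ *m y) i 0]mxE mulr_sumr.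
      by apply: eq_bigr => j _; rewrite [_^T _ _]mxE /f; ring.
    rewrite Rintegral_sum//; last by move=> j;
        have := integrableZl measurableT (weight s * y j 0) (fi j).
    rewrite mulr_sumr; apply: eq_bigr => j _.
    by rewrite RintegralZl// [_^T _ _]mxE mxexpectationE /f; ring.
  rewrite /normc2 sqr_sqrtr ?dotc_ge0// dotcZl dotcC dotcZl !mulrA; congr (_ * _).
  (* The exponents combine as [(1 - alpha) + 2 (alpha - 1) = alpha - 1], the weight of the scalar
     product. *)
  have Ts : T - s != 0 by rewrite subr_eq0 gt_eqF.
  rewrite -!powRD ?Ts ?implybT//; congr powR; ring.
transitivity (\int[mu]_sigma dotc (mittag_leffler alpha 1 (T `^ alpha *: A sigma) *m x0 sigma) y).
  rewrite unlock; congr fine; apply: eq_integral => sigma _.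
  by rewrite right_RL_adjoint_state// -dotc_mulmxl.
rewrite /dotc Rintegral_sum//.
  apply: eq_bigr => i _; rewrite RintegralZr//; first by rewrite mxexpectationE.
  exact: mul_x0_integrable.
by move=> i; have := integrableZr measurableT (y i 0) (mul_x0_integrable i ix0).
Qed.

End MinimumNormControl.

(** Existence of a minimizer is asserted first, so the second part is not vacuous; uniqueness of the
    control is almost everywhere on []0, T[], as fits elements of [L^oo]. *)
Theorem proposition4p29 (R : realType) (alpha T : R) (n m : nat)
    (d : measure_display) (S : measurableType d) (mu : probability S R)
    (A : S -> 'M[R]_n) (B : S -> 'M[R]_(n, m))
    (alpha01 : 0 < alpha < 1) (T_gt0 : 0 < T)
    (n_gt0 : (0 < n)%N) (m_gt0 : (0 < m)%N)
    (A_Linfty : mxLfun mu +oo%E A) (B_Linfty : mxLfun mu +oo%E B)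
    (controllable : exactly_controllable_in_average alpha T mu A B)
    (x0 : S -> 'cV[R]_n) (x1 : 'cV[R]_n) (x0_L1 : mxLfun mu 1%E x0) :
  (exists yT : 'cV[R]_n, is_minimizer_Ja alpha T mu A B x0 x1 yT) /\
  (forall yT : 'cV[R]_n, is_minimizer_Ja alpha T mu A B x0 x1 yT ->
    is_min_norm_control alpha T mu A B x0 x1 (ua alpha T mu A B yT) /\
    (forall v : R -> 'cV[R]_m,
      is_min_norm_control alpha T mu A B x0 x1 v ->
      v = ua alpha T mu A B yT %[ae (@lebesgue_measure R) in `]0, T[%classic])).
Proof.
pose G := gramian alpha T mu A B; pose b := x1 - free_state alpha T mu A x0.
pose L := control_map alpha T mu A B; pose I := @wL2_dot R alpha T m.
pose U := ua alpha T mu A B.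
have UT y : admissible_control T (U y) by exact: ua_admissible.
have IU y u : admissible_control T u -> I (U y) u = dotc y (L u) by exact: wL2_dot_ua.
have LU y : L (U y) = G *m y by exact: control_map_ua.
have steersE z0 z u : mxLfun mu 1%E z0 -> admissible_control T u ->
    steers_in_average alpha T mu A B z0 z u <-> L u = z - free_state alpha T mu A z0.
  move=> iz0 uT; rewrite /steers_in_average expectation_caputo_solution// -/(L u).
  by split=> [<-|->]; [rewrite addrC addKr|rewrite addrC subrK].
(* Unique continuation from controllability: some control [u] started from zero data satisfies
   [L u = y], so [dotc y y = I (U y) u], which vanishes when [U y] does. Adding [free_state] of the
   zero datum to the target makes it cancel without being computed. *)
have U0 y : I (U y) (U y) = 0 -> y = 0.
  move=> Uy0; have i0 : mxLfun mu 1%E (fun=> 0 : 'cV[R]_n).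
    by move=> i j; apply/Lfun1_integrable; under [X in EFin \o X]eq_fun do rewrite mxE;
        exact: integrable0.
  have [u [uT /(steersE _ _ _ i0 uT) Lu]] := controllable _ (y + free_state alpha T mu A (fun=> 0)) i0.
  apply: dotc_eq0; rewrite addrK in Lu; rewrite -{2}Lu -IU//.
  by exact: wL2_dot_ae0 (wL2_dot_eq0 alpha01 T_gt0 (UT y) Uy0).
(* If [G *m y = 0], then [I (U y) (U y) = dotc y (G *m y) = 0]. *)
have Gunit : G \in unitmx.
  apply: unitmx_ker0 => y Gy; apply: U0; rewrite IU// LU Gy.
  by rewrite /dotc big1// => i _; rewrite mxE mulr0.
have Gsym y z : dotc y (G *m z) = dotc z (G *m y).
  by rewrite -!LU -!IU//; exact: wL2_dotC.
pose y0 := invmx G *m b.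
have Gy0 : G *m y0 = b by rewrite mulmxA mulmxV// mul1mx.
(* Completing the square around [y0], the solution of [G *m y0 = b]; this gives both existence and
   uniqueness of the minimizer. *)
have JE y : Ja alpha T mu A B x0 x1 y =
    Ja alpha T mu A B x0 x1 y0 + 2^-1 * I (U (y - y0)) (U (y - y0)).
  rewrite !JaE// -/G -/b IU// LU mulmxBr; move: Gy0; generalize b => c Gy0.
  by rewrite !dotcBl !dotcBr Gy0 (Gsym y0 y) Gy0 (dotcC c y) (dotcC c y0); field.
split.
  exists y0 => y; rewrite [leRHS]JE lerDl mulr_ge0 ?invr_ge0//; exact: wL2_dot_ge0.
move=> yT ymin.
have {ymin} -> : yT = y0.
  apply/eqP; rewrite -subr_eq0; apply/eqP; apply: U0; apply/eqP.
  rewrite eq_le wL2_dot_ge0 andbT.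
  by have := ymin y0; rewrite (JE yT) gerDl pmulr_rle0// invr_gt0.
have Usteers : steers_in_average alpha T mu A B x0 x1 (U y0).
  by apply/steersE => //; rewrite LU.
(* Every steering [v] has [L v = b], hence [I (U y0) v = dotc y0 b = I (U y0) (U y0)]: the
   difference [v - U y0] is orthogonal to [U y0]. *)
have pythagoras v : admissible_control T v -> steers_in_average alpha T mu A B x0 x1 v ->
    I v v = I (U y0) (U y0) + I (v \- U y0) (v \- U y0).
  move=> vT /(steersE _ _ _ x0_L1 vT) Lv.
  have dT := admissibleB vT (UT y0).
  have UvE : I (U y0) v = I (U y0) (U y0) by rewrite !IU// LU Gy0 Lv.
  have IB u w z : admissible_control T u -> admissible_control T w ->
      admissible_control T z -> I (u \- w) z = I u z - I w z by exact: wL2_dotBl.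
  have IC u w : I u w = I w u by exact: wL2_dotC.
  by rewrite IB// (IC v) (IC (U y0)) !IB// (IC v (U y0)) UvE; ring.
split; first split => // v vT vsteers.
  by rewrite /wL2_norm ler_sqrt ?wL2_dot_ge0// -/(I _ _) -/(I v v) (pythagoras v)// lerDl;
      exact: wL2_dot_ge0.
move=> v [vT vsteers vmin].
(* A second minimizer has norm at most that of [U y0], so the Pythagorean excess must vanish. *)
have := vmin _ (UT y0) Usteers.
rewrite /wL2_norm ler_sqrt ?wL2_dot_ge0// -/(I v v) -/(I (U y0) (U y0)) (pythagoras v)// gerDl => d0.
have d1 : I (v \- U y0) (v \- U y0) = 0.
  by apply/eqP; rewrite eq_le d0; exact: wL2_dot_ge0.
have d2 := wL2_dot_eq0 alpha01 T_gt0 (admissibleB vT (UT y0)) d1.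
apply: (filterS (F := almost_everywhere (@lebesgue_measure R)) _ d2) => s vs sT.
by apply/eqP; rewrite -subr_eq0; apply/eqP; exact: vs.
Qed.
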